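(* Let $f\in\mathbb{Z}[x]$ be irreducible over $\mathbb{Q}$ with degree $d\ge 2$, and for each positive integer $N$ let $L_f(N)=\operatorname{lcm}\{f(n):1\le n\le N\}$. Then $\log L_f(N)\gtrsim N\log N$ as $N\to\infty$; that is, for every $\epsilon>0$ there is $N_0$ (depending on $f$ and $\epsilon$) such that $N\log N\le(1+\epsilon)\log L_f(N)$ for all integers $N\ge N_0$.
   Context: The least common multiple is taken to be a positive integer; values of $0$ are ignored in the LCM, and the LCM of an empty set is $1$. ''Irreducible over $\mathbb{Q}$'' means irreducible as an element of $\mathbb{Q}[x]$ (so $f$ need not be primitive). *)

(* Defs.v *)
From HB Require Import structures.
From mathcomp Require Import all_boot all_order all_algebra.
From mathcomp Require Import reals exp.
Set Implicit Arguments.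
Unset Strict Implicit.
Unset Printing Implicit Defensive.
Import Order.TTheory GRing.Theory Num.Theory.
Local Open Scope ring_scope.

Definition irreducible_over_rat (f : {poly int}) : Prop :=
  irreducible_poly (map_poly intr f : {poly rat}).

(* Zero values are skipped, since lcmn 0 m = 0. *)
Definition lcm_values (f : {poly int}) (N : nat) : nat :=
  \big[lcmn/1%N]_(1 <= n < N.+1 | f.[n%:Z] != 0) `|f.[n%:Z]|%N.

(* Main.v *)
Require Import Defs.
From HB Require Import structures.
From mathcomp Require Import all_boot all_order perm all_algebra.
From mathcomp Require Import reals sequences exp.
From mathcomp Require Import zify ring lra.
Set Implicit Arguments.
Unset Strict Implicit.
Unset Printing Implicit Defensive.
Import Order.TTheory GRing.Theory Num.Theory.
Local Open Scope ring_scope.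

(* Write [d = deg f].  The product of the [f(m)], [m <= N], has logarithm about [d N ln N].
   Primes [p <= c N] contribute at most [(1 + o(1)) N ln N].  For [p > c N], if [p] divided [d]
   of the values, then [f] would split mod [p] with roots in [1, N], and their sum would
   contradict Vieta's formula; hence at most [d - 1] values are divisible by [p], and the
   remaining [(d - 1) N ln N] is at most [d - 1] times the logarithm of the lcm.

   The contribution of the small primes needs the upper half of the prime ideal theorem in
   Mertens form: the sum over [p <= x] of [rho(p) ln p / p] is at most [(1 + o(1)) ln x], where
   [rho(p)] counts the roots of [f] mod [p].  It is obtained by multiplying the norms of all
   [g(a theta)] for [g] in a box of side [H] in [Z^d], where [f(theta) = 0].  Each norm is
   [O(H^d)] and, [f] being irreducible, nonzero; on the other hand, for every root [r] mod [p]
   the lattice of [g] with [g(a r) = 0] mod [p] contains its expected share [H^d / p] of the box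
   as long as [p] is at most a small multiple of [H^d], because a nonzero vector of that lattice
   has norm at least [p], hence is not short. *)

(** * Norm forms *)

(* Multiplication by [a * theta] on the basis of powers of a root [theta] of [f], with [a] the
   leading coefficient: the factor [a] makes the matrix integral when [f] is not monic. *)
Definition scaled_companion (f : {poly int}) (n : nat) : 'M[int]_n.+1 :=
  \matrix_(i, j) if i == n :> nat then - f`_j else f`_n.+1 *+ (i.+1 == j).

Definition lincomb (S : pzRingType) (n : nat) (g : 'I_n.+1 -> int) (t : S) : S :=
  \sum_(i < n.+1) (g i)%:~R * t ^+ i.

(* The norm of [lincomb g (a * theta)] from [Q(theta)] to [Q]. *)
Definition norm_form (f : {poly int}) (n : nat) (g : 'I_n.+1 -> int) : int :=
  \det (lincomb g (scaled_companion f n)).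

(** The first basis row vector is cyclic: multiplying it by [C ^+ i] gives the [i]-th one. The last
    row of [C] is arranged so that [f(C)] kills this vector, and since [f(C)] commutes with the
    powers of [C] it kills the whole basis. *)
Lemma companion_root (F : fieldType) (f : {poly F}) (n : nat) (C : 'M[F]_n.+1) :
    size f = n.+2 ->
    (forall i j, C i j = if i == n :> nat then - (f`_j / f`_n.+1)
                         else (i.+1 == j :> nat)%:R) ->
  horner_mx C f = 0.
Proof.
move=> sf CE.
have a0 : f`_n.+1 != 0 by rewrite -[n.+1]/(n.+2.-1) -sf lead_coef_eq0 -size_poly_eq0 sf.
have eC (i : 'I_n.+1) : delta_mx (0 : 'I_1) (0 : 'I_n.+1) *m C ^+ i = delta_mx 0 i.
  case: i => i; elim: i => [|i IH] lt_i.
    by rewrite expr0 mulmx1; congr delta_mx; apply: val_inj.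
  rewrite exprSr mulmxA (IH (ltnW lt_i)) -rowE; apply/rowP => j.
  by rewrite !mxE /= CE /= ltn_eqF //= eq_sym.
have e0 : delta_mx (0 : 'I_1) (0 : 'I_n.+1) *m horner_mx C f = 0.
  rewrite -[f]coefK sf poly_def rmorph_sum /= mulmx_sumr big_ord_recr /=.
  have -> : \sum_(i < n.+1) delta_mx (0 : 'I_1) (0 : 'I_n.+1) *m horner_mx C (f`_i *: 'X^i)
    = \row_j f`_j.
    apply/rowP => j; rewrite summxE (bigD1 j) //= linearZ /= rmorphXn /= horner_mx_X.
    rewrite -scalemxAr eC !mxE !eqxx mulr1 big1 ?addr0 // => k kj.
    rewrite linearZ /= rmorphXn /= horner_mx_X -scalemxAr eC !mxE eqxx /=.
    by rewrite eq_sym (negPf kj) mulr0.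
  rewrite linearZ /= rmorphXn /= horner_mx_X -scalemxAr exprSr mulmxA.
  have /= -> := eC ord_max.
  rewrite -rowE; apply/rowP => j; rewrite !mxE CE /= eqxx mulrN mulrCA divff //.
  by rewrite mulr1 subrr.
apply/row_matrixP => i; rewrite row0 rowE -eC -mulmxA.
have cm : GRing.comm (C ^+ i) (horner_mx C f).
  by apply: commr_sym; apply: commrX; apply: comm_horner_mx.
by rewrite [C ^+ i *m _]cm mulmxA e0 mul0mx.
Qed.

Lemma map_lincomb (S T : pzRingType) (h : {rmorphism S -> T}) (n : nat)
    (g : 'I_n.+1 -> int) (t : S) :
  h (lincomb g t) = lincomb g (h t).
Proof.
by rewrite /lincomb rmorph_sum; apply: eq_bigr => i _; rewrite rmorphM rmorphXn rmorph_int.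
Qed.

Lemma lincombB (S : pzRingType) (n : nat) (g g' : 'I_n.+1 -> int) (x : S) :
  lincomb (fun i => g i - g' i) x = lincomb g x - lincomb g' x.
Proof. by rewrite /lincomb -sumrB; apply: eq_bigr => i _; rewrite rmorphB mulrBl. Qed.

(** The vector [g] is a nonzero polynomial of degree less than that of the irreducible [f], hence
    coprime to it. A Bezout relation evaluated at the companion matrix, where [f] vanishes, makes
    the matrix of [g] invertible over the rationals. *)
Lemma norm_form_neq0 (f : {poly int}) (n : nat) (g : 'I_n.+1 -> int) (i : 'I_n.+1) :
    irreducible_over_rat f -> size f = n.+2 -> g i != 0 ->
  norm_form f g != 0.
Proof.
move=> irr sf gi.
pose fq : {poly rat} := map_poly intr f.
have sfq : size fq = n.+2 by rewrite size_map_inj_poly // => x y /eqP; rewrite eqr_int => /eqP.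
have fqE k : fq`_k = (f`_k)%:~R by rewrite coef_map.
pose a : rat := fq`_n.+1.
have a0 : a != 0 by rewrite /a -[n.+1]/(n.+2.-1) -sfq lead_coef_eq0 -size_poly_eq0 sfq.
pose Mq : 'M[rat]_n.+1 := map_mx intr (scaled_companion f n).
pose C : 'M[rat]_n.+1 := a^-1 *: Mq.
have fC : horner_mx C fq = 0.
  apply: companion_root => // k j; rewrite !mxE.
  case: ifP => _; first by rewrite rmorphN mulrN mulrC /= -fqE.
  by rewrite rmorphMn /= -fqE -/a -mulr_natr mulrA mulVf // mul1r.
(* The powers of [a] compensate for [C] being the companion matrix divided by [a], so that [gq] at
   [C] is the integral matrix of [g]. *)
pose gq : {poly rat} := \poly_(k < n.+1) ((g (inord k))%:~R * a ^+ k).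
have gC : horner_mx C gq = map_mx intr (lincomb g (scaled_companion f n)).
  rewrite (map_lincomb (map_mx intr)) -/Mq /gq poly_def rmorph_sum /=; apply: eq_bigr => k _.
  rewrite linearZ /= rmorphXn /= horner_mx_X /C exprZn scalerA inord_val.
  by rewrite -mulrA exprVn mulfV ?expf_neq0 // mulr1 scaler_int mulrzl.
have g0 : gq != 0.
  apply/eqP => /polyP/(_ i); rewrite coef_poly ltn_ord coef0 inord_val => /eqP.
  by rewrite mulf_eq0 intr_eq0 (negPf gi) expf_eq0 (negPf a0) andbF.
have cop : coprimep fq gq.
  apply: contraT; rewrite /coprimep => sg.
  have /andP[_ fg] := irr.2 _ sg (dvdp_gcdl fq gq).
  have := dvdp_leq g0 (dvdp_trans fg (dvdp_gcdr fq gq)).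
  by rewrite sfq => /leq_trans/(_ (size_poly _ _)); rewrite ltnn.
case/Bezout_eq1_coprimepP: cop => -[u v] /= uv.
have := congr1 (horner_mx C) uv; rewrite rmorphD !rmorphM /= fC mulr0 add0r gC rmorph1.
move/(congr1 determinant); rewrite det1 det_mulmx det_map_mx => h.
apply/eqP => h0; move: h; rewrite -/(norm_form f g) h0 mulr0 => /esym/eqP.
by rewrite oner_eq0.
Qed.

Lemma norm_det_le (R : realDomainType) (n : nat) (A : 'M[R]_n) (b : R) :
    (forall i j, `|A i j| <= b) ->
  `|\det A| <= n`!%:R * b ^+ n.
Proof.
move=> Ab; apply: (le_trans (ler_norm_sum _ _ _)).
rewrite -card_Sn -sum1_card natr_sum mulr_suml; apply: ler_sum => s _.
rewrite normrM normrX normrN1 expr1n !mul1r normr_prod.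
rewrite -[X in b ^+ X]card_ord -prodr_const.
by apply: ler_prod => i _; rewrite normr_ge0 Ab.
Qed.

Lemma lincomb_mxE (S : pzRingType) (n m : nat) (g : 'I_n.+1 -> int) (A : 'M[S]_m.+1) :
  lincomb g A = \sum_(k < n.+1) (g k)%:~R *: A ^+ k.
Proof. by apply: eq_bigr => k _; rewrite mulrzl scaler_int. Qed.

Lemma norm_form_le (f : {poly int}) (n : nat) :
  exists2 c : nat, (0 < c)%N & forall (H : nat) (g : 'I_n.+1 -> int),
    (forall i, `|g i| <= H%:Z) -> (`|norm_form f g| <= c * H ^ n.+1)%N.
Proof.
pose M := scaled_companion f n.
(* The sum of all entries of all powers in absolute value: every entry of [lincomb g M] is then at
   most [H * b], and the Leibniz expansion gives the bound. *)
pose b : nat := (\sum_(k < n.+1) \sum_(i < n.+1) \sum_(j < n.+1) `|(M ^+ k) i j|)%N.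
exists (n.+1`! * b ^ n.+1).+1 => // H g gH.
suff : `|norm_form f g| <= (n.+1`! * (H * b) ^ n.+1)%N%:Z.
  rewrite -abszE lez_nat => /leq_trans; apply.
  by rewrite mulSn expnMn mulnCA mulnC leq_addl.
have -> : (n.+1`! * (H * b) ^ n.+1)%N%:Z = n.+1`!%:R * ((H * b)%N%:Z) ^+ n.+1.
  by rewrite -[LHS]natz natrM natrX !natz.
apply: norm_det_le => i j.
rewrite lincomb_mxE summxE (le_trans (ler_norm_sum _ _ _)) //.
have -> : (H * b)%N%:Z = \sum_(k < n.+1) H%:Z *
    (\sum_(i < n.+1) \sum_(j < n.+1) `|(M ^+ k) i j|)%N%:Z.
  by rewrite -mulr_sumr PoszM; congr (_ * _); rewrite -natz natr_sum; under eq_bigr do rewrite natz.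
apply: ler_sum => k _; rewrite mxE normrM ler_pM ?normr_ge0 //.
  by rewrite intz gH.
rewrite -abszE lez_nat (bigD1 i) //= (bigD1 j) //= -addnA -/M.
exact: leq_addr.
Qed.

(** * Norm forms modulo a prime *)

Lemma Fp_int_eq0 (p : nat) (z : int) : prime p ->
  ((z%:~R : 'F_p) == 0) = (p %| `|z|)%N.
Proof.
move=> pp; rewrite (dvdn_pcharf (pchar_Fp pp)).
by case: z => m //=; rewrite NegzE rmorphN oppr_eq0.
Qed.

(** The column of powers of a root [r] is an eigenvector of the scaled companion matrix with
    eigenvalue [a * r]: all rows but the last shift the powers, and the last row uses [f(r) = 0]. *)
Lemma lincomb_eigen (F : fieldType) (f : {poly int}) (n : nat) (g : 'I_n.+1 -> int) (r : F) :
    size f = n.+2 -> root (map_poly intr f : {poly F}) r ->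
  lincomb g (map_mx intr (scaled_companion f n)) *m \col_(i < n.+1) r ^+ i
    = lincomb g ((f`_n.+1)%:~R * r) *: \col_(i < n.+1) r ^+ i.
Proof.
move=> sf /rootP fr.
set M := map_mx _ _; set v := \col_i _; set t := _ * r.
have Mv : M *m v = t *: v.
  apply/colP => i; rewrite !mxE /t.
  under eq_bigr do rewrite !mxE.
  case: eqP => [->|/eqP ni].
    have : \sum_(j < n.+2) (f`_j)%:~R * r ^+ j = 0.
      rewrite -[RHS]fr (@horner_coef_wide _ n.+2); last by rewrite -sf size_poly.
      by apply: eq_bigr => j _; rewrite coef_map.
    rewrite big_ord_recr /= -mulrA -exprS => /eqP; rewrite addrC addr_eq0 => /eqP ->.
    by rewrite -sumrN; apply: eq_bigr => j _; rewrite rmorphN mulNr.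
  have lti : (i.+1 < n.+1)%N by rewrite ltn_neqAle ltnS eqSS ni -ltnS ltn_ord.
  rewrite (bigD1 (Ordinal lti)) //= eqxx mulr1n big1 ?addr0 -?mulrA -?exprS //.
  by move=> j; rewrite -val_eqE /= eq_sym => /negPf ->; rewrite mulr0n mul0r.
have Mk k : M ^+ k *m v = t ^+ k *: v.
  elim: k => [|k IH]; first by rewrite !expr0 mul1mx scale1r.
  by rewrite exprS -mulmxA IH -scalemxAr Mv scalerA -exprSr.
rewrite lincomb_mxE mulmx_suml scaler_suml; apply: eq_bigr => k _.
by rewrite -scalemxAl Mk scalerA.
Qed.

Definition roots_mod (f : {poly int}) (p : nat) : {set 'F_p} :=
  [set r | root (map_poly intr f : {poly 'F_p}) r].

Lemma card_roots_mod (f : {poly int}) (n p : nat) :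
    size f = n.+2 -> ((f`_n.+1)%:~R : 'F_p) != 0 -> (#|roots_mod f p| <= n.+1)%N.
Proof.
move=> sf a0.
have f0 : (map_poly intr f : {poly 'F_p}) != 0.
  by apply/eqP => /polyP/(_ n.+1)/eqP; rewrite coef_map coef0 (negPf a0).
have rts : all (root (map_poly intr f : {poly 'F_p})) (enum (roots_mod f p)).
  by apply/allP => r; rewrite mem_enum inE.
have := max_poly_roots f0 rts (enum_uniq _).
by rewrite -cardE => /leq_trans h; rewrite -ltnS; apply: h; rewrite -sf size_poly.
Qed.

(* The Vandermonde vectors of the counted roots are independent eigenvectors killed mod [p];
   they are completed by arbitrary residues to an invertible Vandermonde matrix [V], so that
   [p ^ k] divides [\det V] times the norm. *)
Lemma dvdn_norm_form (f : {poly int}) (n p : nat) (g : 'I_n.+1 -> int) :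
    prime p -> (n < p)%N -> size f = n.+2 -> ((f`_n.+1)%:~R : 'F_p) != 0 ->
  (p ^ #|[set r in roots_mod f p | (lincomb g ((f`_n.+1)%:~R * r) == 0)%R]| %| `|norm_form f g|)%N.
Proof.
move=> pp np sf a0; set W := [set r in _ | _]; set k := #|W|.
have kn : (k <= n.+1)%N.
  apply: leq_trans (card_roots_mod sf a0).
  by apply/subset_leq_card/subsetP => r; rewrite inE => /andP[].
(* The counted roots come first, so they are the nodes of the first [k] columns of [V]. *)
pose s := enum W ++ enum (~: W).
have us : uniq s.
  rewrite cat_uniq !enum_uniq andbT /=; apply/hasPn => r.
  by rewrite !mem_enum inE.
have ss : (n.+1 <= size s)%N by rewrite size_cat -!cardE cardsC card_Fp.
pose t (i : 'I_n.+1) : 'F_p := nth 0 s i.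
have t_inj : injective t.
  move=> i j /eqP; rewrite nth_uniq ?(leq_trans (ltn_ord _) ss) // => /eqP; exact: val_inj.
have tW (i : 'I_n.+1) : (i < k)%N -> t i \in W.
  by move=> ik; rewrite /t nth_cat -cardE ik -mem_enum mem_nth // -cardE.
have natFp (r : 'F_p) : ((r : nat)%:Z)%:~R = r by rewrite -[RHS]natr_Zp.
pose V : 'M[int]_n.+1 := Vandermonde n.+1 (\row_i (t i : nat)%:Z).
have VE j i : (V j i)%:~R = t i ^+ j by rewrite !mxE rmorphXn /= natFp.
have [P PE] : {P | P = lincomb g (scaled_companion f n) *m V} by eexists.
have PW (i j : 'I_n.+1) : (i < k)%N -> (p%:Z %| P j i)%Z.
  move=> ik; rewrite dvdzE /= -Fp_int_eq0 //.
  have /setIdP[] := tW i ik; rewrite inE => rt /eqP gt.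
  have := lincomb_eigen g sf rt; rewrite gt scale0r -(map_lincomb (map_mx intr)).
  move=> /colP/(_ j); rewrite !mxE => e.
  rewrite PE mxE rmorph_sum -[X in _ == X]e; apply/eqP/eq_bigr => l _.
  by rewrite rmorphM /= VE !mxE.
(* Each of the first [k] columns of [P] vanishes mod [p], so a factor [p] is pulled out of each. *)
pose Q : 'M[int]_n.+1 := \matrix_(j, i) if (i < k)%N then (P j i %/ p%:Z)%Z else P j i.
have PQ : P = Q *m diag_mx (\row_i if (i < k)%N then p%:Z else 1).
  apply/matrixP => j i; rewrite mul_mx_diag !mxE.
  by case: ifP => ik; rewrite ?mulr1 // divzK // PW.
have dP : (p ^ k %| `|\det P|)%N.
  rewrite PQ det_mulmx det_diag abszM dvdn_mull //.
  under eq_bigr do rewrite mxE.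
  rewrite -big_mkcond /= prodr_const.
  rewrite (_ : #|_| = k); first by rewrite abszX.
  by rewrite -sum1_card -(big_ord_widen _ (fun=> 1%N)) // sum_nat_const card_ord muln1.
move: dP; rewrite PE det_mulmx abszM Gauss_dvdl //.
rewrite coprimeXl // prime_coprime // -Fp_int_eq0 // /V det_Vandermonde rmorph_prod /=.
apply/prodf_neq0 => i _; rewrite rmorph_prod; apply/prodf_neq0 => j ij.
rewrite !mxE rmorphB /= !natFp subr_eq0; apply/eqP => /t_inj /eqP.
by rewrite -val_eqE /= gtn_eqF.
Qed.

(* Each step to the right of a non-full [B s] adds a translate of [B K] disjoint from it. *)
Lemma card_filtration_growth (p : nat) (B : nat -> {set 'F_p}) (K j : nat) :
    (forall k, 0 \in B k) -> 1 \in B 1%N ->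
    (forall k l x y, x \in B k -> y \in B l -> x - y \in B (k + l)%N) ->
  B (K.*2.+1 * j + K)%N = setT \/ (j.+1 * #|B K| <= #|B (K.*2.+1 * j + K)%N|)%N.
Proof.
move=> B0 B1 Bsub.
have Badd k l x y : x \in B k -> y \in B l -> x + y \in B (k + l)%N.
  by move=> xk yl; rewrite -[y]opprK; apply: (Bsub) => //; rewrite -sub0r -[l]add0n; apply: (Bsub).
have Bmon k l : (k <= l)%N -> {subset B k <= B l}.
  by move=> kl x xk; rewrite -(subnKC kl) -[x]addr0; apply: (Badd).
elim: j => [|j [IH|IH]]; first by right; rewrite muln0 mul1n.
  by left; apply/eqP; rewrite -subTset -IH; apply/subsetP/Bmon; rewrite leq_add2r leq_mul.
set s := (K.*2.+1 * j + K)%N in IH *.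
have -> : (K.*2.+1 * j.+1 + K = s + K.+1 + K)%N by rewrite /s mulnS; lia.
have [full|notfull] := boolP (B (s + K)%N == setT).
  by left; apply/eqP; rewrite -subTset -(eqP full); apply/subsetP/Bmon; lia.
right.
(* The multiples of 1 exhaust ['F_p]. The least one outside [B (s + K)] exceeds an element of that
   set by 1, so it lies one index further. *)
have [y [yin ynot]] : exists y, y \in B (s + K.+1)%N /\ y \notin B (s + K)%N.
  have [x xn] : exists x, x \notin B (s + K)%N.
    apply/existsP; apply: contraNT notfull; rewrite negb_exists => /forallP h.
    by apply/eqP/setP => x; rewrite inE; apply/negbNE.
  have : exists m, m%:R \notin B (s + K)%N by exists x; rewrite natr_Zp.
  move=> ex; case: (ex_minnP ex) => -[|m] mn mmin.
    by move: mn; rewrite B0.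
  exists m.+1%:R; split=> //; rewrite -natr1.
  have -> : (s + K.+1 = s + K + 1)%N by lia.
  apply: (Badd) => //.
  by apply: contraT => /mmin; rewrite ltnn.
pose T := [set y + b | b in B K].
have cT : #|T| = #|B K| by apply: card_imset; apply: addrI.
have disj : [disjoint B s & T].
  rewrite disjoint_sym; apply/pred0P => z /=; apply/negP => /andP[/imsetP[b bK ->] zs].
  by move/negP: ynot; apply; rewrite -[y](addrK b y); apply: (Bsub).
rewrite mulSn addnC.
apply: (@leq_trans #|B s :|: T|).
  by rewrite cardsU disjoint_setI0 // cards0 subn0 cT leq_add2r.
apply/subset_leq_card; rewrite subUset; apply/andP; split.
  by apply/subsetP/Bmon; lia.
by apply/subsetP => z /imsetP[b bK ->]; apply: (Badd).
Qed.

(* [K] is the largest size for which [c * K ^ n.+1 < p]; below it the norm bound forces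
   [lincomb] to be injective mod [p], which makes [B K] a positive proportion of ['F_p]. *)
Lemma lincomb_covering (f : {poly int}) (n : nat) :
    irreducible_over_rat f -> size f = n.+2 ->
  exists2 c : nat, (0 < c)%N & forall (p y : nat) (r b : 'F_p),
    prime p -> (n < p)%N -> ((f`_n.+1)%:~R : 'F_p) != 0 -> r \in roots_mod f p ->
    (p <= y ^ n.+1)%N ->
  exists2 g : 'I_n.+1 -> int, (forall i, `|g i| <= (c * y)%N%:Z) &
    b = lincomb g ((f`_n.+1)%:~R * r).
Proof.
move=> irr sf; have [c c0 cP] := norm_form_le f n.
(* The growth lemma is applied with [j = c] and reaches the index [(2 K + 1) c + K], which is at
   most [4 c y] because [K <= y] and both [c] and [y] are positive. *)
exists (4 * c)%N; rewrite ?muln_gt0 // => p y r b pp np a0 rr py.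
set t := _ * r.
pose B k : {set 'F_p} :=
  [set x | [exists v : {ffun 'I_n.+1 -> 'I_k.*2.+1}, x == lincomb (fun i => (v i)%:Z - k%:Z) t]].
have BP k x : reflect (exists2 g : 'I_n.+1 -> int, (forall i, `|g i| <= k%:Z) & x = lincomb g t) (x \in B k).
  rewrite inE; apply: (iffP existsP) => [[v /eqP ->]|[g gk ->]].
    by eexists; last reflexivity; move=> i /=; case: (v i) => m /= lt_m; lia.
  exists [ffun i => inord `|(g i + k%:Z)%R|%N]; apply/eqP/eq_bigr => i _.
  by congr (_%:~R * _); rewrite ffunE inordK; have := gk i; lia.
have B0 k : 0 \in B k.
  apply/BP; exists (fun=> 0) => //.
  by rewrite /lincomb big1 // => i _; rewrite mul0r.
have B1 : 1 \in B 1%N.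
  apply/BP; exists (fun i => (i == 0)%:Z) => [i|]; first by case: (i == 0).
  rewrite /lincomb (bigD1 0) //= mul1r expr0 big1 ?addr0 // => i /negPf ->.
  by rewrite mul0r.
have Bsub k l x x' : x \in B k -> x' \in B l -> x - x' \in B (k + l)%N.
  move=> /BP[g gk ->] /BP[g' gk' ->]; apply/BP; exists (fun i => g i - g' i); last by rewrite lincombB.
  by move=> i; have := gk i; have := gk' i; lia.
have nz (g : 'I_n.+1 -> int) (i : 'I_n.+1) : g i != 0 -> lincomb g t = 0 -> (p <= `|norm_form f g|)%N.
  move=> gi g0; apply: dvdn_leq; first by rewrite absz_gt0 (norm_form_neq0 irr sf gi).
  apply: dvdn_trans (dvdn_norm_form g pp np sf a0).
  rewrite -{1}[p]expn1 dvdn_exp2l // card_gt0; apply/set0Pn; exists r.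
  by rewrite inE rr /= -/t g0.
pose P K := (c * K ^ n.+1 < p)%N.
have P0 : exists K, P K by exists 0%N; rewrite /P exp0n // muln0 prime_gt0.
have Pp K : P K -> (K <= p)%N.
  rewrite /P => /ltnW; apply: leq_trans; apply: leq_trans (leq_pmull _ c0).
  by rewrite -{1}[K]expn1; case: K => // K; rewrite leq_pexp2l.
case: (ex_maxnP P0 Pp) => K PK Kmax.
have Ky : (K <= y)%N.
  rewrite -(@leq_exp2r _ _ n.+1) // (leq_trans _ py) //.
  by apply: ltnW; apply: leq_ltn_trans PK; apply: leq_pmull.
(* By maximality [p <= c * (K + 1) ^ n.+1], and the vectors with entries in [0, K] have distinct
   images: the difference of two with equal image would have a nonzero norm divisible by [p] but
   smaller than [p]. *)
have cB : (p <= c * #|B K|)%N.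
  apply: (@leq_trans (c * K.+1 ^ n.+1)).
    by rewrite leqNgt; apply/negP => /Kmax; rewrite ltnn.
  rewrite leq_mul2l; apply/orP; right.
  pose h (v : {ffun 'I_n.+1 -> 'I_K.+1}) : 'F_p := lincomb (fun i => (v i)%:Z) t.
  have h_inj : injective h.
    move=> v w hvw; apply/ffunP => i; apply/eqP; apply: contraT => vwi.
    pose g i := (v i)%:Z - (w i)%:Z.
    have gi : g i != 0 by rewrite subr_eq0; apply: contraNneq vwi => -[]/val_inj ->.
    have g0 : lincomb g t = 0 by rewrite lincombB -/(h v) -/(h w) hvw subrr.
    suff gK : forall j, `|g j| <= K%:Z.
      by have := leq_trans (nz g i gi g0) (cP K g gK); rewrite leqNgt -/(P K) PK.
    move=> j; rewrite /g; case: (v j) => m /= lt_m; case: (w j) => m' /= lt_m'; lia.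
  have <- : #|codom h| = (K.+1 ^ n.+1)%N by rewrite card_codom // card_ffun !card_ord.
  apply/subset_leq_card/subsetP => x /codomP[v ->]; apply/BP; eexists; last reflexivity.
  by move=> i /=; case: (v i) => m /= lt_m; lia.
(* If the set were not full, it would have at least [(c + 1) * #|B K|] elements, whereas
   [p <= c * #|B K|]. *)
have full : B (K.*2.+1 * c + K)%N = setT.
  case: (card_filtration_growth K c B0 B1 Bsub) => // le_c.
  have := max_card (mem (B (K.*2.+1 * c + K)%N)); rewrite card_Fp // => le_p.
  have := leq_trans le_c le_p; rewrite mulSn => le1.
  have b0 : #|B K| = 0%N by move: cB le1; move: #|B K| => m; lia.
  by move: cB; rewrite b0 muln0 leqNgt prime_gt0.
have : b \in B (K.*2.+1 * c + K)%N by rewrite full inE.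
move=> /BP[g gk ->]; exists g => // i.
have y0 : (0 < y)%N.
  by rewrite lt0n; apply: contraTneq py => ->; rewrite exp0n // -ltnNge prime_gt0.
apply: le_trans (gk i) _; rewrite lez_nat.
have : (K * c <= y * c)%N by rewrite leq_mul2r Ky orbT.
have : (c <= y * c)%N by rewrite leq_pmull.
have : (K <= y * c)%N by rewrite (leq_trans Ky) // leq_pmulr.
lia.
Qed.

(* Subtracting from each vector of a box smaller by [r] on both sides a short representative of
   its residue lands in the lattice, and the residue together with the result is injective. *)
Lemma card_lattice_box (n p H r : nat) (t : 'F_p) :
    prime p ->
    (forall b : 'F_p, exists2 g : 'I_n.+1 -> int,
       forall i, `|g i| <= r%:Z & b = lincomb g t) ->
  ((H - r.*2) ^ n.+1 <=
   p * #|[set v : {ffun 'I_n.+1 -> 'I_H} | (lincomb (fun i => (v i).+1%:Z) t == 0)%R]|)%N.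
Proof.
move=> pp /(fin_all_exists2 (T := 'F_p)) [w wr wE]; set Z := [set v | _].
(* The entries lie in [r + 1, H - r], so subtracting a vector with entries at most [r] in absolute
   value stays within [1, H]. *)
pose sh (u : {ffun 'I_n.+1 -> 'I_(H - r.*2)}) (i : 'I_n.+1) : int := (u i + r.+1)%N%:Z.
pose b u : 'F_p := lincomb (sh u) t.
have shE u i : (sh u i - w (b u) i) = `|(sh u i - w (b u) i - 1)%R|%N.+1%:Z /\
    (`|(sh u i - w (b u) i - 1)%R|%N < H)%N.
  by rewrite /sh; have := wr (b u) i; case: (u i) => m /= lt_m; lia.
pose h u : {ffun 'I_n.+1 -> 'I_H} := [ffun i => Ordinal (shE u i).2].
have hZ u : h u \in Z.
  rewrite inE -(_ : lincomb (fun i => sh u i - w (b u) i) t = lincomb _ t).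
    by rewrite lincombB -wE subrr.
  by apply: eq_bigr => i _; rewrite ffunE /= -(shE u i).1.
have h_inj : injective (fun u => (b u, h u)).
  move=> u u' [bb /ffunP hh]; apply/ffunP => i; apply/val_inj.
  have := congr1 (fun x : 'I_H => x.+1%:Z) (hh i); rewrite !ffunE /= -!(shE _ i).1 bb.
  by move=> /addIr; rewrite /sh; case: (u i) => m /= lt_m; case: (u' i) => m' /= lt_m'; lia.
have <- : #|{ffun 'I_n.+1 -> 'I_(H - r.*2)}| = ((H - r.*2) ^ n.+1)%N.
  by rewrite card_ffun !card_ord.
have <- : #|setX [set: 'F_p] Z| = (p * #|Z|)%N by rewrite cardsX cardsT card_Fp.
rewrite -(card_codom h_inj); apply/subset_leq_card/subsetP => x /codomP[u ->].
by rewrite in_setX inE hZ.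
Qed.

(** * Root-weighted Mertens bound *)

Lemma ln_nat_ge0 (R : realType) (m : nat) : 0 <= ln (m%:R : R).
Proof. by case: m => [|m]; [rewrite ln0 | rewrite ln_ge0 // ler1n]. Qed.

Lemma ler_ln_nat (R : realType) (m m' : nat) : (0 < m)%N -> (m <= m')%N ->
  ln (m%:R : R) <= ln m'%:R.
Proof.
by move=> m0 mm'; rewrite ler_ln ?posrE ?ltr0n ?ler_nat // (leq_trans m0).
Qed.

Lemma ler_sum_nat_sub (R : numDomainType) (a b X : nat) (P : pred nat) (F : nat -> R) :
    (b <= X)%N -> (forall i, 0 <= F i) ->
  \sum_(a <= i < b | P i) F i <= \sum_(0 <= i < X | P i) F i.
Proof.
move=> bX F0; rewrite (big_nat_widen _ _ X) // (big_nat_widenl _ 0) //.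
rewrite big_mkcond [leRHS]big_mkcond; apply: ler_sum => i _.
by case: (P i); case: (_ < _)%N; case: (_ <= _)%N.
Qed.

(** The free upper limit [X] allows many integers to be factored over one common range of primes. *)
Lemma ln_sum_logn (R : realType) (m X : nat) : (0 < m < X)%N ->
  ln (m%:R : R) = \sum_(0 <= p < X | prime p) (logn p m)%:R * ln p%:R.
Proof.
move=> /andP[m0 mX].
have -> : \sum_(0 <= p < X | prime p) (logn p m)%:R * ln p%:R
    = \sum_(0 <= p < m.+1) (logn p m)%:R * ln (p%:R : R).
  rewrite [RHS](big_nat_widen _ _ X) // big_mkcond [RHS]big_mkcond.
  apply: eq_big_nat => p /andP[_ pX] /=; case: ifP => pp; case: ifP => pm //.
    by rewrite lognE pp m0 gtnNdvd ?mul0r // ltnNge -ltnS pm.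
  by rewrite lognE pp mul0r.
rewrite -{1}[m]partnT // /partn natr_prod.
have : forall k, (fun q : R => 0 < q) (\prod_(0 <= p < k) (p ^ logn p m)%:R) /\
   ln (\prod_(0 <= p < k) (p ^ logn p m)%:R) = \sum_(0 <= p < k) (logn p m)%:R * ln (p%:R : R).
  elim=> [|k [IH0 IH]]; first by rewrite !big_geq // ltr01 ln1.
  have k0 : 0 < (k ^ logn k m)%:R :> R.
    rewrite ltr0n expn_gt0; case: posnP => //= ->.
    by rewrite lognE.
  rewrite !big_nat_recr //= mulr_gt0 //; split => //.
  rewrite lnM ?posrE // IH natrX; congr (_ + _).
  have [->|kp] := posnP k; first by rewrite lognE /= expr0 ln1 mul0r.
  by rewrite lnXn ?ltr0n // mulr_natl.
by move=> /(_ m.+1)[_ <-].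
Qed.

Lemma sum_logn_le (R : realType) (m a b : nat) : (0 < m)%N ->
  \sum_(a <= p < b | prime p) (logn p m)%:R * ln (p%:R : R) <= ln m%:R.
Proof.
move=> m0; rewrite (@ln_sum_logn R m (maxn m.+1 b)) ?m0 ?leq_maxl //.
by apply: ler_sum_nat_sub; [rewrite leq_maxr | move=> i; rewrite mulr_ge0 ?ler0n ?ln_nat_ge0].
Qed.

Lemma bernoulli (R : realDomainType) (x : R) (k : nat) : 0 <= x <= 1 ->
  1 - k%:R * x <= (1 - x) ^+ k.
Proof.
move=> /andP[x0 x1]; elim: k => [|k IH]; first by rewrite mul0r subr0 expr0.
have h : (1 - k%:R * x) * (1 - x) <= (1 - x) ^+ k.+1.
  by rewrite exprSr ler_wpM2r // subr_ge0.
apply: le_trans h; rewrite -subr_ge0 -natr1.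
have -> : (1 - k%:R * x) * (1 - x) - (1 - (k%:R + 1) * x) = k%:R * x ^+ 2 by ring.
by rewrite mulr_ge0 ?ler0n ?sqr_ge0.
Qed.

Lemma lead_neq0_mod (f : {poly int}) (n p : nat) :
    size f = n.+2 -> prime p -> (`|(f`_n.+1)%R| < p)%N -> ((f`_n.+1)%:~R : 'F_p) != 0.
Proof.
move=> sf pp ap; rewrite Fp_int_eq0 // gtnNdvd // absz_gt0.
by rewrite -[n.+1]/(n.+2.-1) -sf lead_coef_eq0 -size_poly_eq0 sf.
Qed.

(* Both sides bound the sum, over vectors with entries in [1, H], of the [p]-parts of their norms. *)
Lemma sum_roots_box (R : realType) (f : {poly int}) (n : nat) :
    irreducible_over_rat f -> size f = n.+2 ->
  exists c : nat, exists2 c' : nat, (0 < c')%N & forall (P0 y H : nat),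
    (n <= P0)%N -> (`|(f`_n.+1)%R| <= P0)%N ->
  ((H - (c * y).*2) ^ n.+1)%:R *
     (\sum_(P0.+1 <= p < (y ^ n.+1).+1 | prime p) #|roots_mod f p|%:R * (ln p%:R / p%:R))
   <= (H ^ n.+1)%:R * ln ((c' * H ^ n.+1)%:R : R).
Proof.
move=> irr sf.
have [c' c'0 normP] := norm_form_le f n.
have [c c0 covP] := lincomb_covering irr sf.
exists c, c' => // P0 y H nP aP.
(* Entries start at 1, so no vector of the box is zero and every norm is nonzero. *)
pose g (v : {ffun 'I_n.+1 -> 'I_H}) (i : 'I_n.+1) : int := (v i).+1%:Z.
pose Z v p : {set 'F_p} := [set r in roots_mod f p | (lincomb (g v) ((f`_n.+1)%:~R * r) == 0)%R].
have step v : \sum_(P0.+1 <= p < (y ^ n.+1).+1 | prime p) #|Z v p|%:R * ln (p%:R : R)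
    <= ln (c' * H ^ n.+1)%:R.
  have N0 : (0 < `|norm_form f (g v)|)%N.
    by rewrite absz_gt0 (@norm_form_neq0 f n (g v) 0 irr sf).
  have NH : (`|norm_form f (g v)| <= c' * H ^ n.+1)%N.
    by apply: normP => i; rewrite /g; case: (v i) => m /=; lia.
  apply: le_trans (ler_ln_nat R N0 NH).
  apply: le_trans (sum_logn_le R P0.+1 (y ^ n.+1).+1 N0).
  rewrite big_nat_cond [leRHS]big_nat_cond; apply: ler_sum => p /andP[/andP[Pp _] pp].
  apply: ler_wpM2r; first exact: ln_nat_ge0.
  rewrite ler_nat -pfactor_dvdn // dvdn_norm_form // ?lead_neq0_mod //.
    exact: leq_ltn_trans Pp.
  exact: leq_ltn_trans Pp.
apply: (@le_trans _ _ (\sum_(v : {ffun 'I_n.+1 -> 'I_H})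
    \sum_(P0.+1 <= p < (y ^ n.+1).+1 | prime p) #|Z v p|%:R * ln (p%:R : R))); last first.
  apply: le_trans (ler_sum _ (fun v _ => step v)) _.
  by rewrite sumr_const card_ffun !card_ord -[leLHS]mulr_natl.
rewrite [leRHS]exchange_big mulr_sumr [leLHS]big_nat_cond [leRHS]big_nat_cond.
apply: ler_sum => p /andP[/andP[Pp py] pp].
have p0 : 0 < p%:R :> R by rewrite ltr0n prime_gt0.
rewrite -mulr_suml; set h := _%:R.
have -> : h * (#|roots_mod f p|%:R * (ln p%:R / p%:R)) = h / p%:R * #|roots_mod f p|%:R * ln p%:R.
  by field; rewrite lt0r_neq0.
apply: ler_wpM2r; first exact: ln_nat_ge0.
have -> : \sum_(v : {ffun 'I_n.+1 -> 'I_H}) #|Z v p|%:R =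
    \sum_(r in roots_mod f p) #|[set v | (lincomb (g v) ((f`_n.+1)%:~R * r) == 0)%R]|%:R :> R.
  rewrite -!natr_sum; congr _%:R.
  under eq_bigr do rewrite -sum1_card big_mkcond.
  rewrite exchange_big [RHS]big_mkcond /=; apply: eq_bigr => r _.
  case: ifP => rr.
    rewrite -sum1_card [RHS]big_mkcond; apply: eq_bigr => v _.
    by rewrite !inE -/(roots_mod f p) /=; move: rr; rewrite inE => ->.
  by rewrite big1 // => v _; rewrite inE rr.
rewrite mulr_natr -sumr_const; apply: ler_sum => r rr.
rewrite ler_pdivrMr // -natrM ler_nat [(#|_| * _)%N]mulnC.
apply: card_lattice_box => // b.
by have [] := covP p y r b pp _ _ rr _; rewrite ?lead_neq0_mod ?(leq_ltn_trans _ Pp) //;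
  move=> w w1 w2; exists w.
Qed.

(** Controls the volume lost by shrinking a box by a margin of fixed width [k]. By Bernoulli's
    inequality it suffices that [m] be at least [k * d * (1 + eps) / eps]. *)
Lemma exists_mul_subn_expn_ge (R : realType) (k d : nat) (eps : R) : 0 < eps ->
  exists2 m : nat, (0 < m)%N & (m ^ d)%:R <= (1 + eps) * ((m - k) ^ d)%:R.
Proof.
move=> e0; have e1 : 0 < 1 + eps by lra.
pose z := (k * d)%:R * (1 + eps) / eps.
exists (k + Num.bound z).+1 => //; set m := (_ + _).+1.
have z0 : 0 <= z by rewrite !mulr_ge0 ?ler0n ?invr_ge0 ?ltW.
have zm : z <= m%:R.
  apply: ltW; apply: lt_le_trans (archi_boundP z0) _; rewrite ler_nat /m; lia.
have m0 : 0 < m%:R :> R by rewrite ltr0n.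
have km : (k <= m)%N by rewrite /m; lia.
pose u : R := k%:R / m%:R.
have u01 : 0 <= u <= 1 by rewrite divr_ge0 ?ler0n //= ler_pdivrMr // mul1r ler_nat.
have -> : ((m - k) ^ d)%:R = m%:R ^+ d * (1 - u) ^+ d.
  rewrite -exprMn natrX natrB //; congr (_ ^+ d); rewrite mulrBr mulr1 /u.
  by rewrite mulrCA divff ?mulr1 // lt0r_neq0.
rewrite natrX mulrCA -[leLHS]mulr1 ler_wpM2l ?exprn_ge0 ?ler0n //.
apply: (@le_trans _ _ ((1 + eps) * (1 - d%:R * u))); last first.
  by rewrite ler_wpM2l ?(ltW e1) // bernoulli.
have : (1 + eps) * (d%:R * u) <= eps.
  rewrite /u mulrA mulrA ler_pdivrMr // -ler_pdivrMl //.
  by apply: le_trans zm; rewrite le_eqVlt /z natrM; apply/orP; left; apply/eqP; ring.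
lra.
Qed.

(** Replaces [x] by a perfect power at the cost of a constant factor: for the least [y] whose power
    reaches [x], either [y = 1] or [y <= 2 * (y - 1)]. *)
Lemma exists_expn_between (n x : nat) : (0 < x)%N ->
  exists y, [/\ (0 < y)%N, (x <= y ^ n.+1)%N & (y ^ n.+1 <= 2 ^ n.+1 * x)%N].
Proof.
move=> x0; have ex : exists y, (x <= y ^ n.+1)%N.
  by exists x; rewrite -{1}[x]expn1 leq_pexp2l.
case: (ex_minnP ex) => -[|y] xy ymin; first by move: xy; rewrite exp0n // leqNgt x0.
exists y.+1; split=> //; have [->|y0] := posnP y; first by rewrite exp1n muln_gt0 expn_gt0.
apply: (@leq_trans ((2 * y) ^ n.+1)); first by rewrite leq_exp2r //; lia.
rewrite expnMn leq_mul2l; apply/orP; right.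
by rewrite leqNgt; apply/negP => /ltnW/ymin; rewrite ltnn.
Qed.

(** The box has side [m * y], with [y ^ n.+1] of the order of [x] and [m] depending only on [eps].
    The margin [2 * c * y] is then a small fixed proportion of the side, and the logarithm of the
    norm bound is [ln x] up to a constant. *)
Lemma sum_roots_mertens_le (R : realType) (f : {poly int}) (n : nat) :
    irreducible_over_rat f -> size f = n.+2 ->
  exists P1 : nat, forall eps : R, 0 < eps -> exists A : R,
    forall P0 x : nat, (P1 <= P0)%N -> (0 < x)%N ->
  \sum_(P0.+1 <= p < x.+1 | prime p) #|roots_mod f p|%:R * (ln p%:R / p%:R)
    <= (1 + eps) * ln (x%:R : R) + A.
Proof.
move=> irr sf; have [c [c' c'0 H]] := sum_roots_box R irr sf.
exists (maxn n `|f`_n.+1|) => eps e0.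
have [m m0 mP] := exists_mul_subn_expn_ge c.*2 n.+1 e0.
exists ((1 + eps) * ln (c' * m ^ n.+1 * 2 ^ n.+1)%:R) => P0 x; rewrite geq_max => /andP[nP aP] x0.
have [y [y0 xy yx]] := exists_expn_between n x0.
set S := (leLHS); set C := ln (_ * _)%:R.
have F0 p : 0 <= #|roots_mod f p|%:R * (ln (p%:R : R) / p%:R).
  by rewrite mulr_ge0 ?ler0n // divr_ge0 ?ler0n // ln_nat_ge0.
pose S' : R := \sum_(P0.+1 <= p < (y ^ n.+1).+1 | prime p) #|roots_mod f p|%:R * (ln p%:R / p%:R).
have SS : S <= S'.
  rewrite /S /S' (big_nat_widen _ _ (y ^ n.+1).+1) ?ltnS //.
  rewrite big_mkcond [leRHS]big_mkcond; apply: ler_sum => p _.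
  by case: (prime p) => //=; case: ifP.
have S'0 : 0 <= S' by apply: sumr_ge0.
have := H P0 y (m * y)%N nP aP; rewrite -/S'.
have -> : (m * y - (c * y).*2 = (m - c.*2) * y)%N by rewrite mulnBl; lia.
rewrite !expnMn !natrM; set T : R := (y ^ n.+1)%:R.
have T0 : 0 < T by rewrite ltr0n expn_gt0 y0.
set L := ln _ => HL.
have LE : L <= C + ln x%:R.
  rewrite -lnM ?posrE ?ltr0n ?muln_gt0 ?c'0 ?expn_gt0 ?m0 //.
  rewrite /L -!natrM ler_ln_nat // ?muln_gt0 ?c'0 ?expn_gt0 ?m0 ?y0 //.
  by rewrite -!mulnA !leq_mul2l yx !orbT.
rewrite -mulrDr [ln _ + _]addrC; apply: (le_trans SS).
apply: (@le_trans _ _ ((1 + eps) * L)); last by rewrite ler_wpM2l //; lra.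
have m1 : 0 < (m ^ n.+1)%:R :> R by rewrite ltr0n expn_gt0 m0.
rewrite -(ler_pM2l (mulr_gt0 m1 T0)).
apply: (@le_trans _ _ ((1 + eps) * ((m - c.*2) ^ n.+1)%:R * T * S')).
  by rewrite ler_wpM2r // ler_wpM2r ?(ltW T0).
rewrite [leRHS]mulrCA -2!mulrA ler_wpM2l //; first lra.
by rewrite mulrA.
Qed.

(** * Chebyshev bounds *)

(** The two middle coefficients are equal and their sum is at most [2 ^ (2 m + 1)]. *)
Lemma ln_bin_half_le (R : realType) (m : nat) : ln ('C(m.*2.+1, m)%:R : R) <= m%:R * ln 4%:R.
Proof.
rewrite mulr_natl -lnXn ?ltr0n // -natrX ler_ln_nat ?bin_gt0 //; first lia.
have h : ('C(m.*2.+1, m) + 'C(m.*2.+1, m.+1) <= 2 ^ m.*2.+1)%N.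
  rewrite -[2%N]/(1 + 1)%N expnDn.
  have mm : (m < m.*2.+2)%N by lia.
  have mm1 : (m.+1 < m.*2.+2)%N by lia.
  rewrite (bigD1 (Ordinal mm)) //= (bigD1 (Ordinal mm1)) //=; last by rewrite -val_eqE /=; lia.
  by rewrite !exp1n !muln1 addnA leq_addr.
have e : 'C(m.*2.+1, m.+1) = 'C(m.*2.+1, m).
  by rewrite -bin_sub; [congr 'C(_, _)|]; lia.
move: h; rewrite e addnn expnS mul2n leq_double -mul2n expnM.
by [].
Qed.

Lemma prime_dvd_fact (p m : nat) : prime p -> (p %| m`!)%N -> (p <= m)%N.
Proof.
move=> pp; elim: m => [|m IH]; first by rewrite dvdn1 => /eqP p1; rewrite p1 in pp.
by rewrite factS Euclid_dvdM // => /orP[/dvdn_leq -> //|/IH/leqW].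
Qed.

(** Strong induction after Erdős: an even number above 2 adds no prime, and for [2 m + 1] the primes
    from [m + 2] on all divide the binomial coefficient ['C(2 m + 1, m)]. *)
Lemma sum_ln_prime_le (R : realType) (x : nat) :
  \sum_(0 <= p < x.+1 | prime p) ln (p%:R : R) <= x%:R * ln 4%:R.
Proof.
have l4 : 0 <= ln (4%:R : R) by apply: ln_nat_ge0.
elim/ltn_ind: x => -[|x] IH.
  by rewrite big_mkcond big_nat1 /= mul0r.
have mono : \sum_(0 <= p < x.+1 | prime p) ln (p%:R : R) <= x.+1%:R * ln 4%:R.
  by apply: le_trans (IH x (ltnSn _)) _; rewrite ler_wpM2r // ler_nat.
rewrite big_mkcond big_nat_recr //= -big_mkcond.
case: ifP => px; last by rewrite addr0.
have [x2|x2] := leqP x 1.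
  have -> : x = 1%N by case: x x2 px {IH mono} => [|[|]].
  rewrite big_mkcond big_ltn // big_ltn // big_geq //= !add0r.
  apply: (@le_trans _ _ (ln 4%:R)); first by rewrite ler_ln_nat.
  by rewrite ler_peMl // ler1n.
have ox : odd x.+1 by case: (even_prime px) => //; lia.
have [m xm] : exists m, x = m.*2 by exists x./2; rewrite -[LHS]odd_double_half; move: ox => /=; case: (odd x).
have m0 : (0 < m)%N by lia.
apply: (@le_trans _ _ (\sum_(0 <= p < x.+2 | prime p) ln p%:R)).
  by rewrite [leRHS]big_mkcond big_nat_recr //= px -big_mkcond.
rewrite (@big_cat_nat _ _ _ m.+2) //=; last lia.
have h1 := IH m.+1 ltac:(lia).
have h2 : \sum_(m.+2 <= p < x.+2 | prime p) ln (p%:R : R) <= m%:R * ln 4%:R.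
  apply: le_trans (ln_bin_half_le R m).
  have b0 : (0 < 'C(m.*2.+1, m))%N by rewrite bin_gt0; lia.
  apply: le_trans (sum_logn_le R m.+2 x.+2 b0).
  rewrite big_nat_cond [leRHS]big_nat_cond; apply: ler_sum => p /andP[/andP[mp pX] pp].
  rewrite ler_peMl ?ln_nat_ge0 // ler1n logn_gt0 mem_primes pp b0 /=.
  have : (p %| (m.*2.+1)`!)%N by apply: dvdn_fact; rewrite prime_gt0 //=; lia.
  have mm : (m <= m.*2.+1)%N by lia.
  rewrite -(bin_fact mm) !Euclid_dvdM // => /orP[//|/orP[]] /(prime_dvd_fact pp); lia.
apply: (le_trans (lerD h1 h2)).
by rewrite -mulrDl ler_wpM2r // -natrD ler_nat; lia.
Qed.

(** Primes above [T] each weigh at least [ln 4 / eta] in the Chebyshev sum, which is at most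
    [x * ln 4]; those up to [T] go into the constant. *)
Lemma prime_count_le (R : realType) (eta : R) : 0 < eta ->
  exists B : R, forall x : nat, \sum_(0 <= p < x.+1 | prime p) 1 <= eta * x%:R + B.
Proof.
move=> e0; pose T := (Num.bound (expR (ln (4%:R : R) / eta))).+1.
have lT : ln (4%:R : R) / eta <= ln T%:R.
  rewrite -[leLHS]expRK ler_ln ?posrE ?expR_gt0 ?ltr0n //.
  apply: ltW; apply: lt_le_trans (archi_boundP (expR_ge0 _)) _.
  by rewrite ler_nat.
have l4 : 0 < ln (4%:R : R) by rewrite ln_gt0 // ltr1n.
have lT0 : 0 < ln (T%:R : R) by apply: lt_le_trans lT; rewrite divr_gt0.
exists T.+1%:R => x.
have h (a b : nat) : (a <= b)%N -> \sum_(a <= p < b | prime p) 1 <= (b - a)%:R :> R.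
  move=> ab; apply: (@le_trans _ _ (\sum_(a <= p < b) 1)).
    by rewrite big_mkcond; apply: ler_sum => p _; case: ifP.
  by rewrite sumr_const_nat.
have [xT|Tx] := leqP x T.
  apply: (le_trans (h _ _ (leq0n _))); rewrite subn0 -[leLHS]add0r; apply: lerD; last by rewrite ler_nat.
  by rewrite mulr_ge0 ?ler0n // ltW.
rewrite (@big_cat_nat _ _ _ T.+1) //=; last by rewrite ltnS ltnW.
rewrite addrC lerD //; last by apply: le_trans (h _ _ _) _; rewrite ?subn0.
rewrite -(ler_pM2r lT0).
apply: (@le_trans _ _ (x%:R * ln 4%:R)).
  apply: le_trans (sum_ln_prime_le R x).
  apply: (@le_trans _ _ (\sum_(T.+1 <= p < x.+1 | prime p) ln p%:R)).
    rewrite mulr_suml big_nat_cond [leRHS]big_nat_cond; apply: ler_sum => p /andP[/andP[Tp _] _].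
    by rewrite mul1r ler_ln_nat // ltnW.
  by apply: ler_sum_nat_sub => // i; apply: ln_nat_ge0.
rewrite mulrAC mulrC ler_wpM2r ?ler0n //.
by rewrite -ler_pdivrMl // mulrC.
Qed.

(** * Multiplicity of a prime in the values of a polynomial *)

Lemma horner_taylor2 (R : comNzRingType) (f : {poly R}) (x h : R) :
  exists s, f.[x + h] = f.[x] + h * (f^`().[x] + h * s).
Proof.
elim/poly_ind: f => [|g c [s gs]]; first by exists 0; rewrite deriv0 !horner0; ring.
exists (g^`().[x] + (x + h) * s); rewrite derivMXaddC !hornerE gs; ring.
Qed.

(** An irreducible [f] cannot divide its nonzero derivative, which has smaller degree, so the two
    are coprime. Clearing denominators yields [D], which serves as a discriminant: modulo a prime
    not dividing it, all roots of [f] are simple. *)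
Lemma irreducible_bezout_deriv (f : {poly int}) (n : nat) :
    irreducible_over_rat f -> size f = n.+2 ->
  exists D : int, D != 0 /\ exists u v : {poly int}, u * f + v * f^`() = D%:P.
Proof.
move=> irr sf; pose fq : {poly rat} := map_poly intr f.
have sfq : size fq = n.+2 by rewrite size_map_inj_poly // => x y /eqP; rewrite eqr_int => /eqP.
have f'E : fq^`() = map_poly intr f^`() by rewrite deriv_map.
have f'0 : fq^`() != 0.
  apply/eqP => /polyP/(_ n)/eqP; rewrite coef_deriv coef0 mulrn_eq0 /=.
  by rewrite -[n.+1]/(n.+2.-1) -sfq lead_coef_eq0 -size_poly_eq0 sfq.
have cop : coprimep fq fq^`().
  apply: contraT; rewrite /coprimep => sg.
  have /andP[_ fg] := irr.2 _ sg (dvdp_gcdl fq fq^`()).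
  have := dvdp_leq f'0 (dvdp_trans fg (dvdp_gcdr fq fq^`())).
  by rewrite leqNgt lt_size_deriv // -size_poly_eq0 sfq.
case/Bezout_eq1_coprimepP: cop => -[u v] /= uv.
have [u' [a a0 uE]] := rat_poly_scale u.
have [v' [b b0 vE]] := rat_poly_scale v.
have aq : (a%:~R : rat) != 0 by rewrite intr_eq0.
have bq : (b%:~R : rat) != 0 by rewrite intr_eq0.
exists (a * b); split; first by rewrite mulf_neq0.
exists (b *: u'), (a *: v').
have inj : injective (map_poly (intr : int -> rat)).
  by apply: map_inj_poly => // x y /eqP; rewrite eqr_int => /eqP.
apply: inj; rewrite rmorphD !rmorphM /= !map_polyZ /= -f'E !map_polyC /= -polyCM.
rewrite -[RHS]mulr1 mul_polyC -uv uE vE -/fq scalerDr -!scalerAl !scalerA.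
by congr (_ *: _ + _ *: _); [rewrite mulrAC divff ?mul1r|rewrite -mulrA divff ?mulr1].
Qed.

(** Uniqueness in Hensel's lemma, allowing for the exponent [e] of [p] in [D]. Taylor's formula
    writes [f(m) - f(m')] as [h * w]; if [p ^ e.+1] divided [w], it would divide [f'(m')] and then
    [D]. So [w] absorbs at most [p ^ e]. *)
Lemma hensel_dvdn (f u v : {poly int}) (D : int) (p k m m' : nat) :
    u * f + v * f^`() = D%:P -> D != 0 -> prime p -> (logn p `|D| < k)%N ->
    (p ^ k %| `|f.[m%:Z]|)%N -> (p ^ k %| `|f.[m'%:Z]|)%N ->
    (p ^ (logn p `|D|).+1 %| `|m%:Z - m'%:Z|)%N ->
  (p ^ (k - logn p `|D|) %| `|m%:Z - m'%:Z|)%N.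
Proof.
move=> uv D0 pp; set e := logn p _ => ek fm fm' pmm.
have [s ts] := horner_taylor2 f m'%:Z (m%:Z - m'%:Z).
move: ts; rewrite subrKC; set h := m%:Z - m'%:Z in pmm *; set w := (_ + _ * s) => ts.
have dD : ~~ (p ^ e.+1 %| `|D|)%N by rewrite pfactor_dvdn ?absz_gt0 // ltnn.
have fe : ((p ^ e.+1)%N%:Z %| f.[m'%:Z])%Z.
  by rewrite dvdzE; apply: dvdn_trans fm'; apply: dvdn_exp2l.
have dw : ~~ (p ^ e.+1 %| `|w|)%N.
  apply: contra dD => dw; rewrite -[(_ %| _)%N]/((p ^ e.+1)%N%:Z %| D)%Z.
  have -> : D = u.[m'%:Z] * f.[m'%:Z] + v.[m'%:Z] * (w - h * s).
    by rewrite /w addrK -!hornerM -hornerD uv hornerC.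
  apply: rpredD; first exact: dvdz_mull.
  apply/dvdz_mull/rpredB; first by rewrite dvdzE.
  by apply: dvdz_mulr; rewrite dvdzE.
have w0 : (0 < `|w|)%N by rewrite lt0n; apply: contra dw => /eqP ->; rewrite dvdn0.
have [->|h0] := posnP `|h|%N; first by rewrite dvdn0.
have : (p ^ k %| `|h| * `|w|)%N.
  have -> : (`|h| * `|w|)%N = `|(f.[m%:Z] - f.[m'%:Z])%R|%N by rewrite -abszM ts addrC addKr.
  rewrite -[(_ %| _)%N]/((p ^ k)%N%:Z %| _)%Z; apply: rpredB; by rewrite dvdzE.
have hw0 : (0 < `|h| * `|w|)%N by rewrite muln_gt0 h0.
move: dw; rewrite (pfactor_dvdn _ pp w0) (pfactor_dvdn _ pp hw0) (pfactor_dvdn _ pp h0).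
rewrite (lognM _ h0 w0) -leqNgt leq_subLR => le_w le_k.
by apply: leq_trans le_k _; rewrite addnC leq_add2r.
Qed.

Lemma count_congruent_le (P : pred nat) (q N : nat) : (0 < q)%N ->
    (forall m m', P m -> P m' -> m = m' %[mod q]) ->
  (\sum_(1 <= m < N.+1) P m <= (N %/ q).+1)%N.
Proof.
move=> q0 Pq; pose s := [seq m <- index_iota 1 N.+1 | P m].
have -> : (\sum_(1 <= m < N.+1) P m = size s)%N.
  by rewrite size_filter -sum1_count [RHS]big_mkcond; apply: eq_bigr => m _; case: (P m).
rewrite -(size_map (fun m => m %/ q)%N) -[leqRHS](size_iota 0).
apply: uniq_leq_size => [|x /mapP[m]].
  rewrite map_inj_in_uniq; first by rewrite filter_uniq // iota_uniq.
  move=> m m'; rewrite !mem_filter => /andP[Pm _] /andP[Pm' _] mm'.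
  by rewrite (divn_eq m q) (divn_eq m' q) mm' (Pq m m').
rewrite mem_filter mem_index_iota => /andP[_ /andP[_ mN]] ->.
by rewrite mem_iota /= add0n ltnS leq_div2r.
Qed.

(** The counted [m] are split by their class mod [p ^ e.+1], which must be a root of [f] mod [p].
    Within one class Hensel's lemma makes them all congruent mod [p ^ (k - e)]. *)
Lemma count_value_dvd_le (f u v : {poly int}) (D : int) (p k N : nat) :
    u * f + v * f^`() = D%:P -> D != 0 -> prime p -> (logn p `|D| < k)%N ->
  (\sum_(1 <= m < N.+1) (p ^ k %| `|f.[m%:Z]|)
   <= #|[set c : 'I_(p ^ (logn p `|D|).+1) | (p %| `|f.[(c : nat)%:Z]|)%N]|
        * (N %/ p ^ (k - logn p `|D|)).+1)%N.
Proof.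
move=> uv D0 pp; set e := logn p _ => ek; set C := [set c | _].
have q0 j : (0 < p ^ j)%N by rewrite expn_gt0 prime_gt0.
have dvd_mod (d m m' : nat) : (d %| `|m%:Z - m'%:Z|)%N = (m == m' %[mod d])%N.
  by rewrite -[LHS]/(d%:Z %| m%:Z - m'%:Z)%Z -eqz_mod_dvd !modz_nat eqz_nat.
have hin m : (p ^ k %| `|f.[m%:Z]|)%N ->
    exists2 c : 'I_(p ^ e.+1), c \in C & (m %% p ^ e.+1 == c)%N.
  move=> fm; exists (Ordinal (ltn_pmod m (q0 e.+1))) => //=; rewrite inE /=.
  have [s ts] := horner_taylor2 f m%:Z ((m %% p ^ e.+1)%N%:Z - m%:Z).
  rewrite subrKC in ts; rewrite ts -[(_ %| _)%N]/(p%:Z %| _)%Z; apply: rpredD.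
    by rewrite dvdzE; apply: dvdn_trans fm; rewrite -{1}[p]expn1 dvdn_exp2l //; lia.
  apply: dvdz_mulr; rewrite dvdzE; apply: (@dvdn_trans (p ^ e.+1)).
    by rewrite -{1}[p]expn1 dvdn_exp2l.
  by rewrite dvd_mod modn_mod.
apply: (@leq_trans (\sum_(1 <= m < N.+1) \sum_(c in C)
    ((p ^ k %| `|f.[m%:Z]|) && (m %% p ^ e.+1 == c)))%N).
  apply: leq_sum => m _; case: (boolP (p ^ k %| _)%N) => // /hin[c cC mc].
  by rewrite (bigD1 c) //= mc.
rewrite exchange_big /= -sum_nat_const; apply: leq_sum => c _.
apply: count_congruent_le => // m m' /andP[fm /eqP mc] /andP[fm' /eqP mc'].
apply/eqP; rewrite -dvd_mod; apply: (hensel_dvdn uv) => //.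
by rewrite dvd_mod mc mc'.
Qed.

(** * Exponent of a prime in the product of the values *)

Definition total_mult (f : {poly int}) (p N : nat) : nat :=
  \sum_(1 <= m < N.+1) logn p `|f.[m%:Z]|.

Lemma value_neq0 (f : {poly int}) (n : nat) (x : int) :
    irreducible_over_rat f -> size f = n.+2 -> (0 < n)%N -> f.[x] != 0.
Proof.
move=> irr sf n0; apply/eqP => fx.
have sfq : size (map_poly intr f : {poly rat}) = n.+2.
  by rewrite size_map_inj_poly // => u v /eqP; rewrite eqr_int => /eqP.
have : root (map_poly intr f : {poly rat}) x%:~R by rewrite rootE horner_map /= fx.
rewrite -dvdp_XsubCl => /irr.2; rewrite size_XsubC => /(_ isT) /eqp_size.
by rewrite size_XsubC sfq => -[] n1; rewrite -n1 in n0.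
Qed.

Lemma value_le (f : {poly int}) (d : nat) : (size f <= d.+1)%N ->
  exists2 c : nat, (0 < c)%N & forall m, (0 < m)%N -> (`|f.[m%:Z]| <= c * m ^ d)%N.
Proof.
move=> sf; exists (\sum_(i < d.+1) `|(f`_i)%R|).+1%N => // m m0.
have : `|f.[m%:Z]| <= (\sum_(i < d.+1) `|(f`_i)%R| * m ^ d)%N%:Z.
  rewrite (horner_coef_wide _ sf); apply: le_trans (ler_norm_sum _ _ _) _.
  rewrite -[leRHS]natz natr_sum; apply: ler_sum => i _.
  rewrite normrM natz PoszM abszE ler_wpM2l // -[Posz (_ ^ _)]natz natrX natz.
  by rewrite ger0_norm ?exprn_ge0 // -!natz -!natrX ler_nat leq_pexp2l // -ltnS.
rewrite -abszE lez_nat => /leq_trans; apply.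
by rewrite -big_distrl /= leq_mul2r leqnSn orbT.
Qed.

Lemma value_ge (f : {poly int}) (n : nat) :
    irreducible_over_rat f -> size f = n.+2 -> (0 < n)%N ->
  exists2 c : nat, (0 < c)%N & forall m, (m ^ n.+1 <= c * `|f.[m%:Z]|)%N.
Proof.
move=> irr sf n0.
pose g := f - (f`_n.+1) *: 'X^(n.+1).
have sg : (size g <= n.+1)%N.
  apply/leq_sizeP => j; rewrite leq_eqVlt => /orP[/eqP <-|jn].
    by rewrite coefB coefZ coefXn eqxx mulr1 subrr.
  by rewrite coefB coefZ coefXn gtn_eqF // mulr0 subr0 nth_default // sf.
have [b b0 gb] := value_le sg.
(* For [m > 2 b] the lower-order part of [f(m)] is at most half of [m ^ n.+1], which gives the
   factor 2; for smaller [m] the power [(2 b) ^ n.+1] suffices because [f(m)] is a nonzero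
   integer. *)
exists (2 + (2 * b) ^ n.+1)%N => // m.
have f0 : (0 < `|f.[m%:Z]|)%N by rewrite absz_gt0 (value_neq0 _ irr sf).
have [mb|mb] := leqP m (2 * b).
  apply: (@leq_trans ((2 * b) ^ n.+1)); first by rewrite leq_exp2r.
  by apply: (@leq_trans (2 + (2 * b) ^ n.+1)); rewrite ?leq_addl ?leq_pmulr.
have m0 : (0 < m)%N by lia.
have a1 : (0 < `|(f`_n.+1)%R|)%N.
  by rewrite absz_gt0 -[n.+1]/(n.+2.-1) -sf lead_coef_eq0 -size_poly_eq0 sf.
have tri : (m ^ n.+1 <= `|f.[m%:Z]| + `|g.[m%:Z]|)%N.
  apply: (@leq_trans (`|(f`_n.+1)%R| * m ^ n.+1)); first by rewrite leq_pmull.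
  have -> : (`|(f`_n.+1)%R| * m ^ n.+1)%N = `|(f.[m%:Z] - g.[m%:Z])%R|%N.
    by rewrite /g !hornerE opprB addrC subrK abszM abszX.
  by rewrite -lez_nat PoszD !abszE ler_normB.
have h1 := gb m m0.
have h2 : (2 * b * m ^ n <= m ^ n.+1)%N by rewrite expnS leq_mul2r (ltnW mb) orbT.
apply: (@leq_trans (2 * `|f.[m%:Z]|)); last by rewrite leq_mul2r leq_addr orbT.
move: tri h1 h2; rewrite -mulnA; move: (m ^ n.+1)%N (b * m ^ n)%N => s t.
move: `|f.[m%:Z]|%N `|g.[m%:Z]|%N => x y. lia.
Qed.

Lemma sum_divn_expn_le (p N K : nat) : (1 < p)%N ->
  (p.-1 * \sum_(1 <= k < K.+1) N %/ p ^ k <= N)%N.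
Proof.
(* Keeping the last quotient [N %/ p ^ K] on the left makes the sum telescope. *)
move=> p1; suff : (p.-1 * (\sum_(1 <= k < K.+1) N %/ p ^ k) + N %/ p ^ K <= N)%N.
  by apply: leq_trans; apply: leq_addr.
elim: K => [|K IH]; first by rewrite big_geq // muln0 expn0 divn1.
rewrite big_nat_recr //= mulnDr; apply: leq_trans IH; rewrite -addnA leq_add2l.
by rewrite addnC -mulSn prednK ?(ltnW p1) // expnSr divnMA mulnC leq_divM.
Qed.

Lemma logn_sum_dvd (p v K : nat) : prime p -> (0 < v)%N -> (logn p v <= K)%N ->
  logn p v = (\sum_(1 <= k < K.+1) (p ^ k %| v))%N.
Proof.
move=> pp v0 vK.
rewrite -{1}[logn p v]subn0 -[LHS](subSS 0%N) -[LHS]muln1 -sum_nat_const_nat.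
rewrite (big_nat_widen _ _ K.+1) ?ltnS // big_mkcond /=.
by apply: eq_bigr => k _; rewrite pfactor_dvdn // ltnS; case: (_ <= _)%N.
Qed.

(** Exchanges the sums over [m] and over the exponents [k]: the quotients add up to at most
    [N / (p - 1)], and each of the [K] roundings costs 1. Multiplying by [p - 1] keeps the
    inequality among natural numbers. *)
Lemma total_mult_le (f : {poly int}) (p N K c : nat) :
    prime p -> (forall m, 0 < `|f.[m%:Z]|)%N ->
    (forall m, (0 < m <= N)%N -> (logn p `|f.[m%:Z]| <= K)%N) ->
    (forall k, (0 < k)%N ->
       (\sum_(1 <= m < N.+1) (p ^ k %| `|f.[m%:Z]|) <= c * (N %/ p ^ k).+1)%N) ->
  (p.-1 * total_mult f p N <= c * (N + p.-1 * K))%N.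
Proof.
move=> pp f0 fK cntc.
have -> : total_mult f p N = (\sum_(1 <= k < K.+1) \sum_(1 <= m < N.+1) (p ^ k %| `|f.[m%:Z]|))%N.
  rewrite exchange_big_nat /= /total_mult; apply: eq_big_nat => m mN.
  by apply: logn_sum_dvd => //; apply: fK.
apply: (@leq_trans (p.-1 * \sum_(1 <= k < K.+1) (c * (N %/ p ^ k).+1))).
  rewrite leq_mul2l; apply/orP; right; rewrite big_nat_cond [leqRHS]big_nat_cond.
  by apply: leq_sum => k /andP[/andP[k0 _] _]; apply: cntc.
rewrite -big_distrr /= mulnCA leq_mul2l; apply/orP; right.
under eq_bigr do rewrite -addn1.
rewrite big_split /= mulnDr leq_add ?sum_divn_expn_le ?prime_gt1 //.
by rewrite sum_nat_const_nat subSS subn0 muln1.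
Qed.

Lemma total_mult_ln_le (R : realType) (f : {poly int}) (p N V c : nat) :
    prime p -> (forall m, 0 < `|f.[m%:Z]|)%N ->
    (forall m, (0 < m <= N)%N -> (`|f.[m%:Z]| <= V)%N) -> (0 < V)%N ->
    (forall k, (0 < k)%N ->
       (\sum_(1 <= m < N.+1) (p ^ k %| `|f.[m%:Z]|) <= c * (N %/ p ^ k).+1)%N) ->
  (total_mult f p N)%:R * ln (p%:R : R)
    <= c%:R * (N%:R * (ln p%:R / p.-1%:R) + ln V%:R).
Proof.
move=> pp f0 fV V0 cntc; have p1 := prime_gt1 pp.
have p10 : 0 < p.-1%:R :> R by rewrite ltr0n -subn1 subn_gt0.
have lp := ln_nat_ge0 R p.
(* No value is divisible by a higher power of [p], and [K * ln p <= ln V], so the roundings cost at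
   most [c * ln V] for this prime. *)
pose K := trunc_log p V.
have fK m : (0 < m <= N)%N -> (logn p `|f.[m%:Z]| <= K)%N.
  move=> mN; apply: trunc_log_max => //; apply: leq_trans (fV m mN).
  by apply: dvdn_leq; rewrite ?pfactor_dvdnn.
have KV : K%:R * ln (p%:R : R) <= ln V%:R.
  rewrite mulr_natl -lnXn ?ltr0n ?prime_gt0 // -natrX ler_ln_nat ?expn_gt0 ?prime_gt0 //.
  exact: trunc_logP.
have := total_mult_le pp f0 fK cntc; rewrite -(ler_nat R) !natrM natrD natrM => H.
apply: (@le_trans _ _ (c%:R * (N%:R * (ln p%:R / p.-1%:R) + K%:R * ln p%:R))).
  rewrite -(ler_pM2l p10) [leLHS]mulrA.
  apply: le_trans (ler_wpM2r lp H) _; rewrite le_eqVlt; apply/orP; left; apply/eqP.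
  by field; rewrite lt0r_neq0.
by rewrite ler_wpM2l ?ler0n // lerD2l.
Qed.

Lemma card_root_classes_le (f : {poly int}) (p : nat) : prime p ->
  (#|[set c : 'I_(p ^ 1) | (p %| `|f.[(c : nat)%:Z]|)%N]| <= #|roots_mod f p|)%N.
Proof.
move=> pp; pose h (c : 'I_(p ^ 1)) : 'F_p := (c : nat)%:R.
have h_inj : injective h.
  move=> c c' /(congr1 val); rewrite /h /= !val_Fp_nat // !modn_small ?(leq_trans (ltn_ord _)) ?expn1 //.
  exact: val_inj.
rewrite -(card_imset _ h_inj); apply/subset_leq_card/subsetP => r /imsetP[c].
by rewrite !inE => pc ->; rewrite rootE /h pmulrn horner_map /= Fp_int_eq0.
Qed.

Lemma total_mult_good (R : realType) (f u v : {poly int}) (D : int) (p N V : nat) :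
    u * f + v * f^`() = D%:P -> D != 0 -> prime p -> (`|D| < p)%N ->
    (forall m, 0 < `|f.[m%:Z]|)%N ->
    (forall m, (0 < m <= N)%N -> (`|f.[m%:Z]| <= V)%N) -> (0 < V)%N ->
  (total_mult f p N)%:R * ln (p%:R : R)
    <= #|roots_mod f p|%:R * (N%:R * (ln p%:R / p.-1%:R) + ln V%:R).
Proof.
move=> uv D0 pp Dp f0 fV V0; apply: total_mult_ln_le => // k k0.
have e0 : logn p `|D| = 0%N by rewrite lognE pp absz_gt0 D0 gtnNdvd // absz_gt0.
have := count_value_dvd_le (p := p) (k := k) N uv D0 pp; rewrite e0 subn0 => /(_ k0)/leq_trans; apply.
by rewrite leq_mul2r card_root_classes_le ?orbT.
Qed.

(** Handles any single prime, including divisors of [D], with a constant depending on [p]; it is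
    applied to finitely many primes only. *)
Lemma total_mult_any (R : realType) (f u v : {poly int}) (D : int) (p : nat) :
    u * f + v * f^`() = D%:P -> D != 0 -> prime p ->
    (forall m, 0 < `|f.[m%:Z]|)%N ->
  exists2 C : R, 0 <= C & forall N V : nat,
    (forall m, (0 < m <= N)%N -> (`|f.[m%:Z]| <= V)%N) -> (0 < V)%N ->
    (total_mult f p N)%:R * ln (p%:R : R) <= C * (N%:R + ln V%:R).
Proof.
move=> uv D0 pp f0; set e := logn p `|D|; pose c := (2 * p ^ e.+1 * p ^ e)%N.
have q0 j : (0 < p ^ j)%N by rewrite expn_gt0 prime_gt0.
have lp := ln_nat_ge0 R p.
exists (c%:R * (1 + ln p%:R)) => [|N V fV V0]; first by rewrite mulr_ge0 ?addr_ge0 ?ler0n.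
have lV := ln_nat_ge0 R V.
apply: (@le_trans _ _ (c%:R * (N%:R * (ln p%:R / p.-1%:R) + ln V%:R))).
  apply: total_mult_ln_le => // k k0.
  have p1 : (1 <= p ^ e.+1)%N by rewrite q0.
  have [ke|ke] := leqP k e.
    apply: (@leq_trans N).
      apply: (@leq_trans (\sum_(1 <= m < N.+1) 1)%N).
        by apply: leq_sum => m _; case: (_ %| _)%N.
      by rewrite sum_nat_const_nat subSS subn0 muln1.
    apply: (@leq_trans (p ^ k * (N %/ p ^ k).+1)); first by rewrite ltnW // mulnC ltn_ceil.
    rewrite leq_mul2r; apply/orP; right; rewrite /c.
    apply: leq_trans (leq_pmull _ _); first by rewrite leq_exp2l // prime_gt1.
    by rewrite muln_gt0.
  apply: leq_trans (count_value_dvd_le N uv D0 pp ke) _.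
  rewrite -/e; set C := #|_|.
  have CP : (C <= p ^ e.+1)%N by rewrite /C (leq_trans (max_card _)) ?card_ord.
  apply: leq_trans (leq_mul CP (leqnn _)) _.
  rewrite /c [(2 * _)%N]mulnC -!mulnA leq_mul2l; apply/orP; right.
  have h : (N %/ p ^ (k - e) < p ^ e * (N %/ p ^ k).+1)%N.
    have pk : (p ^ k = p ^ e * p ^ (k - e))%N by rewrite -expnD subnKC // ltnW.
    by rewrite ltn_divLR // mulnAC -pk mulnC ltn_ceil.
  by apply: (leq_trans h); apply: leq_pmull.
rewrite -mulrA ler_wpM2l ?ler0n //.
have h : ln (p%:R : R) / p.-1%:R <= ln p%:R.
  by rewrite ler_pdivrMr ?ltr0n -?subn1 ?subn_gt0 ?prime_gt1 // ler_peMr // ler1n subn_gt0 prime_gt1.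
have hN := ler_wpM2l (ler0n R N) h.
have := mulr_ge0 lp lV; have := ler0n R N; nra.
Qed.

(* If [p] divided [n.+1] values, [f] would split mod [p] with these [n.+1] roots, and Vieta's
   formula for their sum would give a multiple of [p] that is too small unless it vanishes. *)
Lemma count_value_dvd_large_prime (f : {poly int}) (n : nat) :
    irreducible_over_rat f -> size f = n.+2 -> (0 < n)%N ->
  exists2 c : nat, (0 < c)%N & exists N1 : nat, forall N p : nat, (N1 <= N)%N -> prime p -> (c * N < p)%N ->
  (\sum_(1 <= m < N.+1) (p %| `|f.[m%:Z]|) <= n)%N.
Proof.
move=> irr sf n0.
have [b b0 fb] := value_le (eq_leq sf).
pose a0 := `|(f`_n)%R|%N; pose a1 := `|(f`_n.+1)%R|%N.
have a1_gt0 : (0 < a1)%N by rewrite absz_gt0 -[n.+1]/(n.+2.-1) -sf lead_coef_eq0 -size_poly_eq0 sf.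
(* The coefficient [h_n] below is at most [a0 + a1 * n.+1 * N] in absolute value, so a prime above
   [c * N] dividing it forces it to vanish. *)
exists (a0 + a1 * n.+1 + 1)%N; first by rewrite addn1.
(* If [h_n] vanishes, then [a0 = a1 * S] bounds every [m] in [s]; [f(m)] is then at most
   [b * a0 ^ n.+1 < N < p], a contradiction. *)
exists (b * a0 ^ n.+1).+1%N => N p N1 pp cN.
have Np : (N < p)%N by apply: leq_ltn_trans cN; rewrite addn1 leq_pmull.
rewrite leqNgt; apply/negP => big.
pose s0 := [seq m <- index_iota 1 N.+1 | (p %| `|f.[m%:Z]|)%N].
have ss0 : (n < size s0)%N.
  rewrite size_filter -sum1_count big_mkcond; apply: leq_trans big _.
  by apply: leq_sum => m _; case: (_ %| _)%N.
pose s := take n.+1 s0.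
have ss : size s = n.+1 by rewrite size_takel.
have sP m : m \in s -> (0 < m <= N)%N /\ (p %| `|f.[m%:Z]|)%N.
  by move/mem_take; rewrite mem_filter mem_index_iota ltnS => /andP[-> ->].
have us : uniq s by rewrite take_uniq // filter_uniq // iota_uniq.
pose P : {poly int} := \prod_(m <- s) ('X - m%:Z%:P).
have sP1 : size P = n.+2 by rewrite /P size_prod_XsubC ss.
have PE : P = \prod_(x <- [seq m%:Z | m <- s]) ('X - x%:P) by rewrite big_map.
(* Its degree is at most [n], yet it has [n.+1] distinct roots mod [p], so it vanishes mod [p]; its
   coefficient of index [n] carries Vieta's formula. *)
pose h := f - f`_n.+1 *: P.
have Plead : P`_n.+1 = 1.
  by have /monicP := monic_prod_XsubC s xpredT (fun m => m%:Z); rewrite lead_coefE -/P sP1.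
have sh : (size h <= n.+1)%N.
  apply/leq_sizeP => j; rewrite leq_eqVlt => /orP[/eqP <-|jn].
    by rewrite coefB coefZ Plead mulr1 subrr.
  have fj : f`_j = 0 by rewrite nth_default ?sf.
  have Pj : P`_j = 0 by rewrite nth_default ?sP1.
  by rewrite coefB coefZ fj Pj mulr0 subr0.
have hn : h`_n = f`_n + f`_n.+1 * (\sum_(m <- s) m)%N%:Z.
  have := @coefPn_prod_XsubC _ [seq m%:Z | m <- s]; rewrite -PE size_map ss /= => Pn.
  rewrite coefB coefZ Pn // mulrN opprK big_map; congr (_ + _ * _).
  by rewrite -natz natr_sum; under [RHS]eq_bigr do rewrite natz.
have h0 : map_poly intr h = 0 :> {poly 'F_p}.
  apply: (@roots_geq_poly_eq0 _ _ [seq m%:R | m <- s]).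
  - apply/allP => r /mapP[m ms ->]; have [mN pm] := sP m ms.
    rewrite rootE pmulrn horner_map /= /h !hornerE rmorphB rmorphM /= subr_eq0.
    have -> : P.[m%:Z] = 0.
      by apply/eqP; rewrite -rootE PE root_prod_XsubC map_f.
    by rewrite mulr0 Fp_int_eq0.
  - rewrite map_inj_in_uniq // => m m' /sP[/andP[_ mN] _] /sP[/andP[_ mN'] _] /(congr1 val).
    by rewrite /= !val_Fp_nat // !modn_small // (leq_ltn_trans _ Np).
  - by rewrite size_map ss (leq_trans (size_poly _ _)).
have pd : (p %| `|(h`_n)%R|)%N by rewrite -Fp_int_eq0 // -coef_map /= h0 coef0.
set S := (\sum_(m <- s) m)%N in hn.
have SN : (S <= n.+1 * N)%N.
  rewrite -ss /S -sum1_size big_distrl /= !big_seq; apply: leq_sum => m /sP[/andP[_ mN] _].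
  by rewrite mul1n.
have [m ms] : exists m, m \in s by exists (head 0%N s); move: ss; case: (s) => //= m l _; rewrite mem_head.
have [/andP[m0 mN] pm] := sP m ms.
have mS : (m <= S)%N by rewrite /S (big_rem m) //= leq_addr.
have hz : h`_n = 0.
  apply/eqP; rewrite -absz_eq0; apply: contraT; rewrite -lt0n => hp.
  have := leq_trans cN (dvdn_leq hp pd).
  have : (`|(h`_n)%R| <= a0 + a1 * S)%N.
    rewrite hn -lez_nat PoszD PoszM !abszE; apply: le_trans (ler_normD _ _) _.
    by rewrite normrM.
  have : (a1 * S <= a1 * (n.+1 * N))%N by rewrite leq_mul2l SN orbT.
  have : (a0 <= a0 * N)%N by rewrite leq_pmulr // (leq_trans m0).
  rewrite !mulnDl mul1n mulnA.
  move: (`|_|%N) (a1 * S)%N (a0 * N)%N (a1 * n.+1 * N)%N => A B C D; lia.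
have a0S : a0 = (a1 * S)%N.
  move/eqP: hz; rewrite hn addr_eq0 => /eqP e.
  by rewrite /a0 e abszN abszM.
have ma0 : (m <= a0)%N by rewrite a0S (leq_trans mS) // leq_pmull.
have f0 : (0 < `|f.[m%:Z]|)%N by rewrite absz_gt0 (value_neq0 _ irr sf).
have := leq_trans (dvdn_leq f0 pm) (fb m m0); rewrite leqNgt => /negP; apply.
apply: leq_ltn_trans Np; apply: leq_trans (ltnW N1).
by rewrite leq_mul2l leq_exp2r // ma0 orbT.
Qed.

(** * Prime exponents in the least common multiple *)

Lemma lcm_values_gt0 (f : {poly int}) (N : nat) : (0 < lcm_values f N)%N.
Proof.
apply: (big_ind (fun x => 0 < x)%N) => // [x y x0 y0|m]; first by rewrite lcmn_gt0 x0.
by rewrite absz_gt0.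
Qed.

Lemma dvdn_lcm_values (f : {poly int}) (m N : nat) : (0 < m <= N)%N -> f.[m%:Z] != 0 ->
  (`|f.[m%:Z]| %| lcm_values f N)%N.
Proof.
move=> mN fm; rewrite /lcm_values.
have : m \in index_iota 1 N.+1 by rewrite mem_index_iota ltnS.
elim: (index_iota 1 N.+1) => // x s IH; rewrite inE big_cons => /orP[/eqP <-|/IH ms].
  by rewrite fm dvdn_lcml.
by case: ifP => // _; apply: dvdn_trans ms (dvdn_lcmr _ _).
Qed.

(** Each value divisible by [p] contributes at most the exponent of [p] in the lcm, and there are at
    most [n] of them. *)
Lemma total_mult_le_lcm (f : {poly int}) (p N n : nat) :
    prime p -> (forall m : nat, f.[m%:Z] != 0) ->
    (\sum_(1 <= m < N.+1) (p %| `|f.[m%:Z]|) <= n)%N ->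
  (total_mult f p N <= n * logn p (lcm_values f N))%N.
Proof.
move=> pp f0 cn; apply: leq_trans (leq_mul cn (leqnn _)).
rewrite big_distrl /= /total_mult big_nat_cond [leqRHS]big_nat_cond.
apply: leq_sum => m /andP[mN _].
have fm : (0 < `|f.[m%:Z]|)%N by rewrite absz_gt0.
case: (boolP (p %| _)%N) => pm; last by rewrite lognE pp fm (negPf pm).
by rewrite mul1n dvdn_leq_log ?lcm_values_gt0 // dvdn_lcm_values.
Qed.

(** * Comparison of the product and the least common multiple *)

Lemma ler_ln_id (R : realType) (N : nat) : ln (N%:R : R) <= N%:R.
Proof.
case: N => [|N]; first by rewrite ln0.
by apply: ltW; apply: ln_sublinear; rewrite ltr0n.
Qed.

Lemma sum_ln_ge (R : realType) (N : nat) :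
  N%:R * ln (N%:R : R) - N%:R <= \sum_(1 <= m < N.+1) ln (m%:R : R).
Proof.
elim: N => [|N IH]; first by rewrite big_geq // mul0r subr0.
rewrite big_nat_recr //=; apply: le_trans (lerD IH (lexx _)).
have [->|N0] := posnP N; first by rewrite ln1; lra.
have Np : 0 < N%:R :> R by rewrite ltr0n.
have h : ln (N.+1%:R : R) - ln N%:R <= N%:R^-1.
  rewrite -ln_div ?posrE ?ltr0n // -natr1 mulrDl divff ?lt0r_neq0 // mul1r.
  by apply: le_ln1Dx; apply: lt_trans (_ : 0 < _); rewrite ?ltrN10 ?invr_gt0.
have := ler_wpM2l (ltW Np) h; rewrite divff ?lt0r_neq0 // -natr1.
by move: (ln (N%:R + 1 : R)) (ln (N%:R : R)) => x y; nra.
Qed.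

Lemma sum_ln_values_ge (R : realType) (f : {poly int}) (n : nat) :
    irreducible_over_rat f -> size f = n.+2 -> (0 < n)%N ->
  exists C : R, forall N : nat, n.+1%:R * (N%:R * ln N%:R) - C * N%:R
    <= \sum_(1 <= m < N.+1) ln (`|f.[m%:Z]|%N%:R : R).
Proof.
move=> irr sf n0; have [c c0 fc] := value_ge irr sf n0.
exists (n.+1%:R + ln c%:R) => N.
apply: (@le_trans _ _ (\sum_(1 <= m < N.+1) (n.+1%:R * ln (m%:R : R) - ln c%:R))); last first.
  rewrite big_nat_cond [leRHS]big_nat_cond; apply: ler_sum => m /andP[/andP[m0 _] _].
  have f0 : (0 < `|f.[m%:Z]|)%N by rewrite absz_gt0 (value_neq0 _ irr sf).
  rewrite lerBlDr -lnM ?posrE ?ltr0n // mulr_natl -lnXn ?ltr0n // -natrX -natrM mulnC.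
  by rewrite ler_ln_nat // expn_gt0 m0.
rewrite sumrB -mulr_sumr sumr_const_nat subSS subn0.
have := ler_wpM2l (ler0n R n.+1) (sum_ln_ge R N).
rewrite -[ln c%:R *+ N]mulr_natr; move: (\sum_(1 <= m < N.+1) ln (m%:R : R)) => S.
by move: (ln (N%:R : R)) (ln (c%:R : R)) (n.+1%:R : R) (N%:R : R) => x y z t; nra.
Qed.

Lemma sum_total_mult (R : realType) (f : {poly int}) (N X : nat) :
    (forall m, 0 < `|f.[m%:Z]|)%N -> (forall m, (0 < m <= N)%N -> (`|f.[m%:Z]| < X)%N) ->
  \sum_(1 <= m < N.+1) ln (`|f.[m%:Z]|%N%:R : R)
    = \sum_(0 <= p < X | prime p) (total_mult f p N)%:R * ln p%:R.
Proof.
move=> f0 fX.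
under [RHS]eq_bigr do rewrite natr_sum mulr_suml.
rewrite exchange_big_nat /=; apply: eq_big_nat => m mN.
by apply: ln_sum_logn; rewrite f0 fX.
Qed.

Lemma sum_total_mult_bounded_primes (R : realType) (f u v : {poly int}) (D : int) (P0 : nat) :
    u * f + v * f^`() = D%:P -> D != 0 -> (forall m, 0 < `|f.[m%:Z]|)%N ->
  exists2 C : R, 0 <= C & forall N V : nat,
    (forall m, (0 < m <= N)%N -> (`|f.[m%:Z]| <= V)%N) -> (0 < V)%N ->
    \sum_(0 <= p < P0 | prime p) (total_mult f p N)%:R * ln (p%:R : R) <= C * (N%:R + ln V%:R).
Proof.
move=> uv D0 f0; elim: P0 => [|P0 [C C0 IH]].
  by exists 0 => // N V _ _; rewrite big_geq // mul0r.
have [pp|np] := boolP (prime P0); last first.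
  by exists C => // N V fV V0; rewrite big_mkcond big_nat_recr //= (negPf np) addr0 -big_mkcond IH.
have [C' C'0 H] := total_mult_any R uv D0 pp f0.
exists (C + C') => [|N V fV V0]; first exact: addr_ge0.
by rewrite big_mkcond big_nat_recr //= pp -big_mkcond mulrDl lerD ?IH ?H.
Qed.

(** Primes up to a fixed [P0] cost [O(N)]. Above [P0], the density terms are summed by the Mertens
    bound, and the rounding terms, each at most [d * ln V], by the bound on the number of primes up
    to [c * N]. *)
Lemma sum_total_mult_small_primes (R : realType) (f : {poly int}) (n c : nat) (eps : R) :
    irreducible_over_rat f -> size f = n.+2 -> (0 < n)%N -> (0 < c)%N -> 0 < eps ->
  exists A : R, forall N : nat, (0 < N)%N ->
    \sum_(0 <= p < (c * N).+1 | prime p) (total_mult f p N)%:R * ln (p%:R : R)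
      <= (1 + eps) * (N%:R * ln N%:R) + A * N%:R.
Proof.
move=> irr sf n0 c0 e0.
have f0 m : (0 < `|f.[m%:Z]|)%N by rewrite absz_gt0 (value_neq0 _ irr sf).
have [b b0 fb] := value_le (eq_leq sf).
have [D [D0 [u [v uv]]]] := irreducible_bezout_deriv irr sf.
(* One factor [1 + dl] comes from the Mertens bound and one from replacing [p - 1] by [p]; their
   product is at most [1 + eps / 2]. *)
pose dl : R := Num.min 1 (eps / 6).
have dl0 : 0 < dl by rewrite lt_min ltr01 divr_gt0.
have dl1 : dl <= 1 by rewrite ge_min lexx.
have dle : dl <= eps / 6 by rewrite ge_min lexx orbT.
have [P1 mert] := sum_roots_mertens_le R irr sf.
have [A1 {}mert] := mert dl dl0.
have [P0 [P10 DP aP bP]] : exists P0,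
    [/\ P1 <= P0, `|D| <= P0, `|(f`_n.+1)%R| <= P0 & Num.bound dl^-1 <= P0]%N.
  exists (maxn (maxn P1 `|D|) (maxn `|(f`_n.+1)%R| (Num.bound dl^-1))).
  by rewrite !leq_max !leqnn !orbT.
have [C0 C00 small] := sum_total_mult_bounded_primes R P0.+1 uv D0 f0.
pose d : R := n.+1%:R.
have d0 : 0 < d by rewrite ltr0n.
have c0R : 0 < c%:R :> R by rewrite ltr0n.
(* As [ln V] is [d * ln N] up to a constant, this choice makes the rounding terms contribute
   [eps / 2] times [N ln N] in the main. *)
pose eta : R := eps / (2 * (d * d * c%:R)).
have eta0 : 0 < eta by rewrite divr_gt0 // !mulr_gt0.
have [B cnt] := prime_count_le eta0.
pose lb : R := ln b%:R; pose lc : R := ln c%:R.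
have lb0 : 0 <= lb := ln_nat_ge0 R b.
have lc0 : 0 <= lc := ln_nat_ge0 R c.
exists (C0 * (1 + lb + d) + 4 * (lc + `|A1|) + d * (eta * c%:R * lb + `|B| * (lb + d))) => N N0.
pose V := (b * N ^ n.+1)%N.
have V0 : (0 < V)%N by rewrite muln_gt0 b0 expn_gt0 N0.
have fV m : (0 < m <= N)%N -> (`|f.[m%:Z]| <= V)%N.
  by move=> /andP[m0 mN]; apply: leq_trans (fb m m0) _; rewrite leq_mul2l leq_exp2r // mN orbT.
pose x : R := N%:R; pose l : R := ln x.
have x1 : 1 <= x by rewrite ler1n.
have l0 : 0 <= l := ln_nat_ge0 R N.
have lx : l <= x := ler_ln_id R N.
have lV : ln V%:R = lb + d * l :> R.
  by rewrite /V natrM lnM ?posrE ?ltr0n ?expn_gt0 ?N0 // natrX lnXn ?ltr0n // -[ln _ *+ _]mulr_natl.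
have F0 p : 0 <= (total_mult f p N)%:R * ln (p%:R : R) by rewrite mulr_ge0 ?ler0n ?ln_nat_ge0.
have split : \sum_(0 <= p < (c * N).+1 | prime p) (total_mult f p N)%:R * ln (p%:R : R)
   <= \sum_(0 <= p < P0.+1 | prime p) (total_mult f p N)%:R * ln (p%:R : R)
    + \sum_(P0.+1 <= p < (c * N).+1 | prime p) (total_mult f p N)%:R * ln (p%:R : R).
  have [cP|Pc] := leqP (c * N) P0.
    by rewrite [X in _ + X]big_geq // addr0 ler_sum_nat_sub.
  by rewrite -big_cat_nat //= ltnW.
have h1 := small N V fV V0; rewrite lV in h1.
have cN0 : (0 < c * N)%N by rewrite muln_gt0 c0.
have h2 : \sum_(P0.+1 <= p < (c * N).+1 | prime p) (total_mult f p N)%:R * ln (p%:R : R)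
   <= x * ((1 + dl) * ((1 + dl) * (lc + l) + A1)) + d * (lb + d * l) * (eta * (c%:R * x) + B).
  apply: (@le_trans _ _ (\sum_(P0.+1 <= p < (c * N).+1 | prime p)
      (x * ((1 + dl) * (#|roots_mod f p|%:R * (ln p%:R / p%:R))) + d * (lb + d * l)))).
    rewrite big_nat_cond [leRHS]big_nat_cond; apply: ler_sum => p /andP[/andP[Pp _] pp].
    have Dp : (`|D| < p)%N by apply: leq_ltn_trans Pp.
    apply: le_trans (total_mult_good R uv D0 pp Dp f0 fV V0) _.
    rewrite mulrDr lV; apply: lerD.
      rewrite mulrCA [leRHS](_ : _ = x * (#|roots_mod f p|%:R * ((1 + dl) * (ln p%:R / p%:R)))); last by ring.
      rewrite ler_wpM2l ?ler0n // ler_wpM2l ?ler0n //.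
      rewrite mulrCA ler_wpM2l ?ln_nat_ge0 //.
      have p10 : 0 < p.-1%:R :> R by rewrite ltr0n -subn1 subn_gt0 prime_gt1.
      have p0 : 0 < p%:R :> R by rewrite ltr0n prime_gt0.
      rewrite ler_pdivlMr // mulrC ler_pdivrMr //.
      (* This is what gives [p <= (1 + dl) * (p - 1)]. *)
      have dp : dl^-1 <= p.-1%:R.
        apply: ltW; apply: lt_le_trans (archi_boundP _) _; first by rewrite invr_ge0 ltW.
        by rewrite ler_nat (leq_trans bP) // -ltnS prednK // prime_gt0.
      have : 1 <= dl * p.-1%:R by rewrite -ler_pdivrMl // mulr1.
      have -> : p%:R = p.-1%:R + 1 :> R by rewrite natr1 prednK // prime_gt0.
      lra.
    rewrite ler_wpM2r ?addr_ge0 ?mulr_ge0 ?(ltW d0) //.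
    rewrite ler_nat card_roots_mod // lead_neq0_mod //.
    exact: leq_ltn_trans Pp.
  have k0 : 0 <= d * (lb + d * l).
    by apply: mulr_ge0; [exact: ltW | apply: addr_ge0 => //; exact: mulr_ge0 (ltW d0) l0].
  move: (d * (lb + d * l)) k0 => k k0.
  rewrite big_split /= -!mulr_sumr; apply: lerD.
    rewrite ler_wpM2l ?ler0n // ler_wpM2l ?addr_ge0 ?(ltW dl0) //.
    rewrite /lc /l -lnM ?posrE ?ltr0n // -natrM; exact: mert.
  have -> : \sum_(P0.+1 <= p < (c * N).+1 | prime p) k = k * \sum_(P0.+1 <= p < (c * N).+1 | prime p) 1.
    by rewrite mulr_sumr; apply: eq_bigr => p _; rewrite mulr1.
  apply: (ler_wpM2l k0); rewrite /x -natrM; apply: le_trans (cnt _).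
  exact: ler_sum_nat_sub.
apply: le_trans split _; apply: le_trans (lerD h1 h2) _.
have i1 : C0 * (x + (lb + d * l)) <= C0 * (1 + lb + d) * x.
  rewrite -mulrA ler_wpM2l //.
  have := ler_wpM2l lb0 x1; have := ler_wpM2l (ltW d0) lx; lra.
have q2 : (1 + dl) * (1 + dl) <= 1 + eps / 2 by nra.
have q4 : (1 + dl) * (1 + dl) <= 4 by nra.
have x0 : 0 <= x by lra.
have i2 : x * ((1 + dl) * ((1 + dl) * l)) <= (1 + eps / 2) * (x * l).
  by rewrite [leLHS](_ : _ = (1 + dl) * (1 + dl) * (x * l)); [rewrite ler_wpM2r ?mulr_ge0 | ring].
have i3 : x * ((1 + dl) * ((1 + dl) * lc)) <= 4 * lc * x.
  rewrite [leLHS](_ : _ = (1 + dl) * (1 + dl) * (lc * x)); last by ring.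
  by rewrite -[leRHS]mulrA ler_wpM2r ?mulr_ge0.
have i4 : x * ((1 + dl) * A1) <= 4 * `|A1| * x.
  rewrite mulrC ler_wpM2r //; apply: (@le_trans _ _ ((1 + dl) * `|A1|)).
    by rewrite ler_wpM2l ?ler_norm ?addr_ge0 ?(ltW dl0).
  by rewrite ler_wpM2r ?normr_ge0 //; lra.
have i5 : d * (d * l) * (eta * (c%:R * x)) = eps / 2 * (x * l).
  have gen (d' c' l' x' : R) : d' != 0 -> c' != 0 ->
      d' * (d' * l') * (eps / (2 * (d' * d' * c')) * (c' * x')) = eps / 2 * (x' * l').
    by move=> d1 c1; field; rewrite d1 c1.
  exact: gen (lt0r_neq0 d0) (lt0r_neq0 c0R).
have i6 : d * (lb + d * l) * B <= d * (`|B| * (lb + d)) * x.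
  rewrite -!mulrA ler_wpM2l ?(ltW d0) //.
  apply: (@le_trans _ _ ((lb + d * l) * `|B|)).
    by rewrite ler_wpM2l ?ler_norm ?addr_ge0 ?mulr_ge0 ?(ltW d0).
  rewrite mulrC ler_wpM2l ?normr_ge0 //.
  have := ler_wpM2l lb0 x1; have := ler_wpM2l (ltW d0) lx; lra.
rewrite -/x -/l; move: i1 i2 i3 i4 i5 i6; lra.
Qed.

Lemma sum_total_mult_large_primes (R : realType) (f : {poly int}) (n N a X : nat) :
    (forall m : nat, f.[m%:Z] != 0) ->
    (forall p, prime p -> (a <= p)%N -> (\sum_(1 <= m < N.+1) (p %| `|f.[m%:Z]|) <= n)%N) ->
  \sum_(a <= p < X | prime p) (total_mult f p N)%:R * ln (p%:R : R)
    <= n%:R * ln (lcm_values f N)%:R.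
Proof.
move=> f0 fp; apply: le_trans (ler_wpM2l (ler0n R n) (sum_logn_le R a X (lcm_values_gt0 f N))).
rewrite mulr_sumr big_nat_cond [leRHS]big_nat_cond; apply: ler_sum => p /andP[/andP[ap _] pp].
rewrite mulrA -natrM ler_wpM2r ?ln_nat_ge0 // ler_nat total_mult_le_lcm //.
exact: fp.
Qed.

Theorem theorem1p3 (R : realType) (f : {poly int}) (d : nat)
  (f_irr : irreducible_over_rat f)
  (deg_f : size f = d.+1) (d_ge2 : (2 <= d)%N)
  (eps : R) (eps_gt0 : 0 < eps) :
  exists N0 : nat, forall N : nat, (N0 <= N)%N ->
    N%:R * ln (N%:R : R) <= (1 + eps) * ln ((lcm_values f N)%:R : R).
Proof.
case: d deg_f d_ge2 => [//|n] sf; rewrite ltnS => n0.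
have f0 (m : nat) : f.[m%:Z] != 0 := value_neq0 _ f_irr sf n0.
have f0' m : (0 < `|f.[m%:Z]|)%N by rewrite absz_gt0.
have n0R : 0 < n%:R :> R by rewrite ltr0n.
have [c c0 [N1 large]] := count_value_dvd_large_prime f_irr sf n0.
have [b b0 fb] := value_le (eq_leq sf).
have [C lower] := sum_ln_values_ge R f_irr sf n0.
(* Chosen so that [1 - 2 * dl] is the inverse of [1 + eps]. One [dl] pays for the small primes,
   whose bound is used with [n * dl], and the other for the terms linear in [N]. *)
pose dl : R := eps / (2 * (1 + eps)).
have e1 : 0 < 1 + eps by rewrite addr_gt0.
have dl0 : 0 < dl by rewrite divr_gt0 ?mulr_gt0.
have dlE : (1 + eps) * (1 - 2 * dl) = 1 by rewrite /dl; field; rewrite lt0r_neq0.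
have [A small] := sum_total_mult_small_primes f_irr sf n0 c0 (mulr_gt0 n0R dl0).
(* Once [ln N >= M], the linear terms [(A + C) * N] are at most [n * dl * N ln N]. *)
pose M : R := (A + C) / (n%:R * dl).
exists (N1 + Num.bound (expR M)).+1 => N NN.
have N0 : (0 < N)%N by apply: leq_trans NN.
have N1N : (N1 <= N)%N by apply: leq_trans NN; rewrite ltnW // ltnS leq_addr.
have lM : M <= ln (N%:R : R).
  rewrite -[leLHS]expRK ler_ln ?posrE ?expR_gt0 ?ltr0n //.
  apply: ltW; apply: lt_le_trans (archi_boundP (expR_ge0 _)) _.
  by rewrite ler_nat; apply: leq_trans NN; rewrite ltnW // ltnS leq_addl.
(* Exceeds both [c * N] and all the values, so that every prime factor falls on one side or the
   other of the cut at [c * N]. *)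
pose X := (c * N + b * N ^ n.+1).+2.
have fX m : (0 < m <= N)%N -> (`|f.[m%:Z]| < X)%N.
  move=> /andP[m0 mN]; apply: (@leq_ltn_trans (b * N ^ n.+1)).
    by apply: leq_trans (fb m m0) _; rewrite leq_mul2l leq_exp2r // mN orbT.
  by rewrite /X ltnS ltnW // ltnS leq_addl.
have := lower N; rewrite (sum_total_mult R f0' fX).
rewrite (@big_cat_nat _ _ _ (c * N).+1) //=; last by rewrite /X ltnS ltnW // ltnS leq_addr.
have hs := small N N0.
have hl : \sum_((c * N).+1 <= p < X | prime p) (total_mult f p N)%:R * ln (p%:R : R)
    <= n%:R * ln (lcm_values f N)%:R.
  by apply: sum_total_mult_large_primes => // p pp cp; apply: large N1N pp cp.
move=> /le_trans/(_ (lerD hs hl)).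
have xM : (A + C) * N%:R <= n%:R * dl * (N%:R * ln N%:R).
  rewrite [leRHS]mulrCA [leLHS]mulrC ler_wpM2l ?ler0n // [leRHS]mulrC.
  by rewrite -ler_pdivrMr ?(mulr_gt0 n0R dl0).
move: xM; rewrite -natr1; move: (N%:R * ln (N%:R : R)) (ln ((lcm_values f N)%:R : R)) => t L xM H.
have key : n%:R * ((1 - 2 * dl) * t) <= n%:R * L by lra.
rewrite ler_pM2l // in key.
have -> : t = (1 + eps) * ((1 - 2 * dl) * t) by rewrite mulrA dlE mul1r.
by rewrite ler_wpM2l // ltW.
Qed.
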